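(* Let $n$ be a positive constant. For any smooth functions $A(t)$ and $Q(t)$, the equation $$u_t + A(t)\,u^n u_x + u^{2n}u_x + u_{xxx} + Q(t)\,u = 0$$ is nonlinearly self-adjoint, and the substitutions $v=\varphi(t,x,u)$ realizing nonlinear self-adjointness are given by $$\varphi = p\,u + q,$$ where, with $c_1,c_2,c_3$ arbitrary constants (such that $\varphi\neq 0$): (i) if $n=\tfrac12$ and $A=0$, then $$p(t)=c_1 e^{2\int Q\,dt}-c_2 e^{2\int Q\,dt}\int e^{-\int Q\,dt}\,dt,\qquad q(t,x)=(c_2 x+c_3)\,e^{\int Q\,dt};$$ (ii) in any other case, $$p(t)=c_1 e^{2\int Q\,dt},\qquad q(t)=c_2 e^{\int Q\,dt}.$$
   Context: Write $F=u_t+A u^n u_x+u^{2n}u_x+u_{xxx}+Qu$ for the left-hand side of the equation. Let $v=v(t,x)$ be a new dependent variable. The adjoint equation is $F^*=0$ with $F^*:=\frac{\delta (vF)}{\delta u}$, where $$\frac{\delta}{\delta u}=\frac{\partial}{\partial u}+\sum_{k\ge 1}(-1)^k D_{i_1}\cdots D_{i_k}\frac{\partial}{\partial u_{i_1\cdots i_k}}$$ is the variational derivative and $D_i$ are the total derivatives with respect to $t$ and $x$ (acting on $u$, $v$ and their derivatives). The equation $F=0$ is called nonlinearly self-adjoint if there is a function $\varphi(t,x,u)\neq 0$ such that, after the substitution $v=\varphi(t,x,u)$ (together with the induced substitutions for the derivatives of $v$), $$F^*\big|_{v=\varphi}=\lambda\,F$$ holds identically in $t,x,u$ and the derivatives of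 $u$, for some differential function $\lambda=\lambda(t,x,u,\ldots)$ (a function of $t,x,u$ and derivatives of $u$). The symbols $\int Q\,dt$ and $\int e^{-\int Q\,dt}\,dt$ denote fixed antiderivatives in $t$, with the same $\int Q\,dt$ used throughout. Powers of $u$ are understood where they are defined. *)

(* Defs.v *)
From HB Require Import structures.
From mathcomp Require Import all_boot all_order all_algebra.
From mathcomp Require Import all_classical all_reals all_analysis.
Set Implicit Arguments.
Unset Strict Implicit.
Unset Printing Implicit Defensive.
Import Order.TTheory GRing.Theory Num.Theory.
Import numFieldNormedType.Exports.
Local Open Scope classical_set_scope.
Local Open Scope ring_scope.

(* f is C^oo on D (meant for D open and V finite-dimensional): every iterated
   directional derivative of f is Frechet differentiable at every point of D. *)
Definition smooth_on (R : realType) (V W : normedModType R) (D : set V)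
    (f : V -> W) : Prop :=
  forall (vs : seq V) (x : V), D x ->
    differentiable (foldr (fun v g => 'D_v g) f vs) x.

Definition open_interval (R : realType) (I : set R) : Prop :=
  [/\ open I, is_interval I & I !=set0].

Definition antiderivative_on (R : realType) (I : set R) (f P : R -> R) : Prop :=
  forall t, I t -> is_derive t (1 : R) P (f t).

(* u to the real power r: the integer power, for every u, when r is a natural
   number, and exp (r ln u) otherwise. The value is meaningful only when
   [rpow_defined u r] holds. *)
Definition rpow (R : realType) (u r : R) : R :=
  if r \is a Num.nat then u ^+ Num.truncn r else u `^ r.

Definition rpow_defined (R : realType) (u r : R) : Prop :=
  0 < u \/ r \is a Num.nat.

(* A point of the jet space of infinite order for two functions u, v of (t, x):
   [ju i j] and [jv i j] are the coordinates of D_t^i D_x^j u and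
   D_t^i D_x^j v. *)
Record jet (R : realType) := Jet {
  jt : R; jx : R; ju : nat -> nat -> R; jv : nat -> nat -> R }.

Section Jets.
Variable R : realType.
Implicit Types (f : jet R -> R) (J : jet R).

Definition set_coord (w : nat -> nat -> R) (i j : nat) (s : R) :
    nat -> nat -> R :=
  fun k l => if (k == i) && (l == j) then s else w k l.

Definition pd_t f : jet R -> R := fun J =>
  derive1 (fun s : R => f (Jet s (jx J) (ju J) (jv J))) (jt J).
Definition pd_x f : jet R -> R := fun J =>
  derive1 (fun s : R => f (Jet (jt J) s (ju J) (jv J))) (jx J).
Definition pd_u (i j : nat) f : jet R -> R := fun J =>
  derive1 (fun s : R => f (Jet (jt J) (jx J) (set_coord (ju J) i j s) (jv J)))
    (ju J i j).
Definition pd_v (i j : nat) f : jet R -> R := fun J =>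
  derive1 (fun s : R => f (Jet (jt J) (jx J) (ju J) (set_coord (jv J) i j s)))
    (jv J i j).

(* The sums below run over all of nat * nat; they have finite support when f
   depends on finitely many coordinates (a sum with infinite support is 0 by
   convention). *)
Definition Dt f : jet R -> R := fun J =>
  pd_t f J +
  \sum_(a \in [set: nat * nat])
     (ju J a.1.+1 a.2 * pd_u a.1 a.2 f J + jv J a.1.+1 a.2 * pd_v a.1 a.2 f J).

Definition Dx f : jet R -> R := fun J =>
  pd_x f J +
  \sum_(a \in [set: nat * nat])
     (ju J a.1 a.2.+1 * pd_u a.1 a.2 f J + jv J a.1 a.2.+1 * pd_v a.1 a.2 f J).

(* delta f / delta u, with one term for each partial derivative
   u_{t...tx...x} (a.1 times t, a.2 times x). *)
Definition var_deriv f : jet R -> R := fun J =>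
  \sum_(a \in [set: nat * nat])
     (-1) ^+ (a.1 + a.2) * iter a.1 Dt (iter a.2 Dx (pd_u a.1 a.2 f)) J.

Definition adjoint f : jet R -> R := var_deriv (fun J => jv J 0%N 0%N * f J).

Definition lift_txu (phi : R * R * R -> R) : jet R -> R :=
  fun J => phi (jt J, jx J, ju J 0%N 0%N).

(* f|_{v = phi}: each v_{ij} is replaced by D_t^i D_x^j (phi(t, x, u)). *)
Definition subst_v (phi : R * R * R -> R) f : jet R -> R := fun J =>
  f (Jet (jt J) (jx J) (ju J)
       (fun i j => iter i Dt (iter j Dx (lift_txu phi)) J)).

Definition box (I X U : set R) : set (R * R * R) :=
  [set p | [/\ I p.1.1, X p.1.2 & U p.2]].

Definition jet_box (I X U : set R) : set (jet R) :=
  [set J | box I X U (jt J, jx J, ju J 0%N 0%N)].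

(* A differential function in u over the box: a smooth function of t, x and
   the u_{ij} with i, j <= N, for some N. *)
Definition differential_function (I X U : set R) (lambda : jet R -> R) : Prop :=
  exists (N : nat) (G : R * R * 'M[R]_N.+1 -> R),
    smooth_on [set p : R * R * 'M[R]_N.+1 |
                 box I X U (p.1.1, p.1.2, p.2 ord0 ord0)] G /\
    forall J, jet_box I X U J ->
      lambda J = G (jt J, jx J, \matrix_(i, j) ju J i j).

(* The substitution v = phi(t, x, u) realizes nonlinear self-adjointness of the
   equation F = 0 over the box; "phi <> 0" means not identically zero. *)
Definition realizes_nsa (I X U : set R) (F : jet R -> R)
    (phi : R * R * R -> R) : Prop :=
  [/\ smooth_on (box I X U) phi,
      exists2 p, box I X U p & phi p != 0 &
      exists2 lambda, differential_function I X U lambda &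
        forall J, jet_box I X U J ->
          subst_v phi (adjoint F) J = lambda J * F J].

Definition nonlinearly_self_adjoint (I X U : set R) (F : jet R -> R) : Prop :=
  exists phi, realizes_nsa I X U F phi.

(* u_t + A(t) u^n u_x + u^(2n) u_x + u_xxx + Q(t) u *)
Definition gkdv (n : R) (A Q : R -> R) : jet R -> R := fun J =>
  let u := ju J 0%N 0%N in let u_x := ju J 0%N 1%N in
  ju J 1%N 0%N + A (jt J) * rpow u n * u_x + rpow u (2 * n) * u_x
  + ju J 0%N 3%N + Q (jt J) * u.

(* The powers of u occurring in the equation are defined on U; the term in u^n
   is absent when A vanishes identically, as in the KdV case n = 1/2. *)
Definition powers_defined (n : R) (A : R -> R) (I U : set R) : Prop :=
  forall u, U u ->
    rpow_defined u (2 * n) /\ ((exists2 t, I t & A t != 0) -> rpow_defined u n).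

End Jets.

(* Main.v *)
Require Import Defs.
From HB Require Import structures.
From mathcomp Require Import all_boot all_order all_algebra.
From mathcomp Require Import all_classical all_reals all_analysis.
From mathcomp Require Import ring lra.
Set Implicit Arguments.
Unset Strict Implicit.
Unset Printing Implicit Defensive.
Import Order.TTheory GRing.Theory Num.Theory.
Import numFieldNormedType.Exports.
Local Open Scope classical_set_scope.
Local Open Scope ring_scope.

(* The adjoint equation is F^* = Q v - v_t - h v_x - v_xxx with
   h(t, u) = A u^n + u^(2n). Evaluating F^*|_{v = phi} = lambda F at the jets with
   F = 0, i.e. eliminating u_t, kills the unknown lambda; comparing coefficients
   of u_x and u_xx then gives phi_uu = 0 and phi_xu = 0, so
   phi = p(t) u + q(t, x), and there remains
     (2 Q p - p') u + (Q q - q_t - q_xxx) = h q_x.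
   As h(t, .) is not constant, q_x depends on t only: q = a(t) x + c(t) with
   a' = Q a. Hence a vanishes identically or nowhere, and in the second case
   h(t, .) is affine in u for every t, which forces n = 1/2 and A = 0. The linear
   equations left for p and c integrate to the stated formulas. *)

(** * Closure properties of smooth functions *)

Section Smooth.
Context {R : realType}.

(** Both cases of the theorem specialize one criterion, [realizes_nsaP], in which the constant c2
    must vanish outside the exceptional case; existence is witnessed by v = exp(int Q), which serves
    every n, A and Q. In the converse direction the factor is lambda = -p. Eliminating u_t
    contributes u_xxx phi_u, which cancels the leading term of D_x^3 phi; the remainder is
    polynomial in u_x and u_xx, and the coefficients of u_x u_xx and of u_xx carry the information.
    Three things shape the details. Total derivatives are sums over all jet coordinates, so sum and
    product rules need finite support and derivability along each coordinate line. Identities hold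
    only over the box: they are differentiated because its sides are open and integrated because its
    sides are intervals. Mixed partials of phi are directional derivatives taken in a definite
    order; they are kept apart until affinity in u identifies them. *)

Lemma smooth_onP (V W : normedModType R) (D : set V) (f : V -> W) :
  smooth_on D f <-> (forall x, D x -> differentiable f x) /\
                    forall v, smooth_on D ('D_v f).
Proof.
split=> [sf|[df sf]].
  split=> [x Dx|v vs x Dx]; first exact: (sf [::]).
  by have := sf (rcons vs v) x Dx; rewrite foldr_rcons.
case/lastP=> [x|vs v x Dx]; first exact: df.
by rewrite foldr_rcons; exact: sf.
Qed.

Lemma smooth_on_differentiable {V W : normedModType R} {D : set V} {f : V -> W} x :
  smooth_on D f -> D x -> differentiable f x.
Proof. by move=> sf Dx; exact: (sf [::]). Qed.

Lemma smooth_on_derive {V W : normedModType R} {D : set V} {f : V -> W} v :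
  smooth_on D f -> smooth_on D ('D_v f).
Proof. by move=> /smooth_onP[]. Qed.

(** The first-order expansion at x only sees values near x, so the differential of [f] also serves
    [g]. *)
Lemma differentiable_near_eq (V W : normedModType R) (f g : V -> W) x :
  (\near x, f x = g x) -> differentiable f x -> differentiable g x.
Proof.
move=> fg df; have fgx := nbhs_singleton fg.
have /diff_locallyP[cdf fE] := df.
have gE : g \o shift x = cst (g x) + 'd f x +o_ (0 : V) id.
  apply/eqaddoP => e e0; have /eqaddoP/(_ e e0) := fE.
  have : \forall y \near (0 : V), f (y + x) = g (y + x).
    by have := fg; rewrite (near_shift 0)/= subr0.
  rewrite -!nbhs_nearE; apply: filterS2 => y fgy.
  by rewrite /= -![(_ + _ : _ -> _) _]/(_ + _) -![(- _ : _ -> _) _]/(- _) /cst /= fgy fgx.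
by apply/diff_locallyP; rewrite (diff_unique cdf gE).
Qed.

Variables (V : normedModType R) (D : set V).
Hypothesis oD : open D.

(** [smooth_on] speaks of all iterated derivatives, so a direct proof for a product or an
    exponential would have to describe ever longer expressions. This class is closed under each
    ['D_v], which reduces smoothness to one differentiation. Composition with continuous linear
    forms covers functions of t alone read on a larger space. *)
Inductive smooth_gen : (V -> R) -> Prop :=
| sgen_smooth f : smooth_on D f -> smooth_gen f
| sgen_eq f g : (forall x, D x -> f x = g x) -> smooth_gen f -> smooth_gen g
| sgen_cst c : smooth_gen (cst c)
| sgen_lin (L : {linear V -> R}) : continuous L -> smooth_gen L
| sgen_add f g : smooth_gen f -> smooth_gen g -> smooth_gen (fun x => f x + g x)
| sgen_mul f g : smooth_gen f -> smooth_gen g -> smooth_gen (fun x => f x * g x)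
| sgen_exp f : smooth_gen f -> smooth_gen (fun x => expR (f x))
| sgen_comp (I : set R) (f : R -> R) (L : {linear V -> R}) : continuous L ->
   (forall x, D x -> I (L x)) -> smooth_on I f -> smooth_gen (fun x => f (L x)).

(** Each differentiation rule returns an expression in the same generators; along a linear form [L]
    the chain rule only adds the constant factor [L v]. *)
Lemma smooth_gen_derive f : smooth_gen f ->
  (forall x, D x -> differentiable f x) /\ forall v, smooth_gen ('D_v f).
Proof.
elim=> {f}.
- move=> f /smooth_onP[df sf]; split=> // v; exact: sgen_smooth.
- move=> f g fg _ [df sf].
  have nfg x : D x -> \near x, f x = g x.
    by move=> Dx; near=> y; apply: fg; near: y; exact: open_nbhs_nbhs.
  split=> [x Dx|v]; first exact: differentiable_near_eq (nfg x Dx) (df x Dx).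
  apply: sgen_eq (sf v) => x Dx; exact/near_eq_derive/nfg.
- move=> c; split=> [x _|v]; first exact: differentiable_cst.
  apply: sgen_eq (sgen_cst 0) => x _; by rewrite derive_cst.
- move=> L cL; split=> [x _|v]; first exact: linear_differentiable.
  apply: sgen_eq (sgen_cst (L v)) => x _.
  by rewrite deriveE ?diff_lin//; exact: linear_differentiable.
- move=> f g _ [df sf] _ [dg sg]; split=> [x Dx|v].
    by apply: differentiableD; [exact: df|exact: dg].
  apply: sgen_eq (sgen_add (sf v) (sg v)) => x Dx.
  by rewrite -deriveD//; apply: diff_derivable; [exact: df|exact: dg].
- move=> f g gf [df sf] gg [dg sg]; split=> [x Dx|v].
    by apply: differentiableM; [exact: df|exact: dg].
  apply: sgen_eq (sgen_add (sgen_mul gf (sg v)) (sgen_mul gg (sf v))) => x Dx.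
  by rewrite -deriveM//; apply: diff_derivable; [exact: df|exact: dg].
- move=> f gf [df sf].
  have de y : differentiable (expR : R -> R) y.
    by apply/derivable1_diffP; exact: derivable_expR.
  split=> [x Dx|v].
    by apply: differentiable_comp (de _); exact: df.
  apply: sgen_eq (sgen_mul (sgen_exp gf) (sf v)) => x Dx.
  rewrite [RHS]deriveE; last by apply: differentiable_comp (de _); exact: df.
  rewrite diff_comp//=; last exact: df.
  rewrite deriveE; last exact: df.
  set w := 'd f x v.
  by rewrite deriv1E ?derive1E ?derive_val; [rewrite mulrC|exact: derivable_expR].
- move=> I f L cL DI sf; split=> [x Dx|v].
    apply: differentiable_comp; first exact: linear_differentiable.
    exact: smooth_on_differentiable sf (DI _ Dx).
  have := sgen_mul (sgen_cst (L v)) (sgen_comp cL DI (smooth_on_derive (1 : R) sf)).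
  apply: sgen_eq => x Dx.
  have dL : differentiable L x by exact: linear_differentiable.
  have dfL := smooth_on_differentiable sf (DI _ Dx).
  rewrite [RHS]deriveE; last by exact: differentiable_comp.
  rewrite diff_comp//= diff_lin// deriv1E ?derive1E//.
  exact/derivable1_diffP.
Unshelve. all: by end_near. Qed.

Lemma smooth_gen_smooth f : smooth_gen f -> smooth_on D f.
Proof.
move=> gf vs; elim/last_ind: vs f gf => [|vs v ih] f gf.
  by have [] := smooth_gen_derive gf.
rewrite foldr_rcons; apply: ih; exact: (smooth_gen_derive gf).2.
Qed.

End Smooth.

(** * Functions of one real variable *)

Section RealAnalysis.
Context {R : realType}.
Implicit Types (I U : set R) (f g : R -> R).

Lemma open_gt_ex I (x : R) : open I -> I x -> exists2 y, I y & x < y.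
Proof.
move=> oI Ix; suff [y []] : exists y, I y /\ x < y by exists y.
apply: (@filter_ex _ (x^'+)); near=> y; split; near: y.
  by apply: cvg_within; exact: open_nbhs_nbhs.
exact: nbhs_right_gt.
Unshelve. all: by end_near. Qed.

Lemma open_lt_ex I (x : R) : open I -> I x -> exists2 y, I y & y < x.
Proof.
move=> oI Ix; suff [y []] : exists y, I y /\ y < x by exists y.
apply: (@filter_ex _ (x^'-)); near=> y; split; near: y.
  by apply: cvg_within; exact: open_nbhs_nbhs.
exact: nbhs_left_lt.
Unshelve. all: by end_near. Qed.

(** The means of differentiating an identity known only on an open set. *)
Lemma is_derive_eq_on I f g x df dg : open I -> I x ->
    (forall y, I y -> f y = g y) ->
  is_derive x (1 : R) f df -> is_derive x (1 : R) g dg -> df = dg.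
Proof.
move=> oI Ix fg [_ <-] [_ <-]; apply: near_eq_derive; near=> y; apply: fg.
by near: y; exact: open_nbhs_nbhs.
Unshelve. all: by end_near. Qed.

Lemma is_derive0_cst I f : is_interval I ->
    (forall x, I x -> is_derive x (1 : R) f 0) ->
  forall x y, I x -> I y -> f x = f y.
Proof.
move=> iI df x y; wlog xy : x y / x <= y => [H Ix Iy|Ix Iy].
  by have [/H ->//|/ltW/H ->] := leP x y.
have sub z : z \in `[x, y] -> I z by rewrite in_itv/= => zxy; apply: iI zxy.
have d z : z \in `]x, y[ -> is_derive z (1 : R) f (cst 0 z).
  by move=> zxy; apply/df/sub; move: zxy; exact: subset_itv_oo_cc.
have cf : {within `[x, y], continuous f}.
  apply: derivable_within_continuous => z /sub/df ?; exact: ex_derive.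
have [c _] := MVT_segment xy d cf.
by rewrite mul0r => /subr0_eq.
Qed.

Lemma is_derive_expR_comp f x df : is_derive x (1 : R) f df ->
  is_derive x (1 : R) (fun y => expR (f y)) (df * expR (f x)).
Proof.
by move=> d; apply: is_derive_eq; rewrite mulrC.
Qed.

(** * Real powers, and when a combination of u^n and u^(2n) is affine *)

Lemma rpow_gt0 (u r : R) : 0 < u -> rpow u r = u `^ r.
Proof.
move=> u0; rewrite /rpow; case: ifPn => // /natrP[k ->].
by rewrite natrK powR_mulrn// ltW.
Qed.

Lemma derivable_rpow (u r : R) : rpow_defined u r ->
  derivable (fun w => rpow w r) u (1 : R).
Proof.
case=> [u0|rN].
  apply: (@near_eq_derivable _ _ _ (fun w => w `^ r)).
    by near=> w; rewrite rpow_gt0//; near: w; exact: lt_nbhsr.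
  by apply: derivable_powR; rewrite in_itv/= u0.
rewrite /rpow rN; exact: exprn_derivable.
Unshelve. all: by end_near. Qed.

(** Two differentiations remove the affine side; dividing by w^(n-2) leaves a multiple of w^n equal
    to a constant, and a third differentiation forces the coefficient b 2n (2n-1) to vanish. *)
Lemma powR_affine_gt0 U (n a b al be : R) : 0 < n -> b != 0 ->
    open U -> U !=set0 -> (forall w, U w -> 0 < w) ->
    (forall w, U w -> a * w `^ n + b * w `^ (2 * n) = al * w + be) ->
  n = 2^-1 /\ a = 0.
Proof.
move=> n0 b0 oU [w0 Uw0] U0 H0.
have P (c r w : R) : U w ->
    is_derive w (1 : R) (fun w => c * w `^ r) (c * r * w `^ (r - 1)).
  move=> /U0 w0'; apply: (is_derive_eq (is_deriveZ c (is_derive1_powR r w0'))).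
  by rewrite -[LHS]/(c * (r * _)) mulrA.
have H1 w : U w ->
    a * n * w `^ (n - 1) + b * (2 * n) * w `^ (2 * n - 1) = al.
  move=> Uw; apply: (is_derive_eq_on oU Uw H0).
    by apply: is_deriveD; exact: P.
  apply: (is_derive_eq (is_deriveD (is_deriveZ al (is_derive_id w 1))
    (is_derive_cst be w 1))).
  by rewrite addr0 -[LHS]/(al * 1) mulr1.
have H2 w : U w ->
    a * n * (n - 1) * w `^ (n - 1 - 1) +
    b * (2 * n) * (2 * n - 1) * w `^ (2 * n - 1 - 1) = 0.
  move=> Uw; apply: (is_derive_eq_on oU Uw H1 _ (is_derive_cst al w 1)).
  by apply: is_deriveD; exact: P.
have H3 w : U w ->
    b * (2 * n) * (2 * n - 1) * w `^ n = - (a * n * (n - 1)).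
  move=> Uw; have w1 : w `^ (n - 1 - 1) != 0.
    by rewrite gt_eqF// powR_gt0// U0.
  apply: (mulfI w1); have := H2 _ Uw.
  rewrite (_ : 2 * n - 1 - 1 = (n - 1 - 1) + n); last by ring.
  rewrite (@powRD _ w (n - 1 - 1) n); last by rewrite (gt_eqF (U0 _ Uw)) implybT.
  by move=> E; apply: subr0_eq; rewrite -[RHS]E; ring.
have n2 : n = 2^-1.
  have : b * (2 * n) * (2 * n - 1) * n * w0 `^ (n - 1) = 0.
    exact: (is_derive_eq_on oU Uw0 H3 (P _ _ _ Uw0)
      (is_derive_cst (- (a * n * (n - 1))) w0 1)).
  move/eqP; rewrite !mulf_eq0 (negPf b0) (gt_eqF n0) pnatr_eq0/=.
  rewrite (gt_eqF (powR_gt0 _ (U0 _ Uw0))) !orbF => /eqP; lra.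
(* At n = 1/2 the left side of [H3] is 0 and the right side is a/4. *)
split=> //; have := H3 _ Uw0; rewrite n2 mulfV ?pnatr_eq0// subrr.
by rewrite mulr0 mul0r; lra.
Qed.

(** [U] may contain negative points. If it meets the positive half-line, the identity restricted to
    that open part is already decisive; otherwise reflection is used. *)
Lemma rpow_affine U (n a b al be : R) : 0 < n -> b != 0 ->
    open U -> U !=set0 ->
    (forall w, U w -> rpow_defined w (2 * n)) ->
    (a != 0 -> forall w, U w -> rpow_defined w n) ->
    (forall w, U w -> a * rpow w n + b * rpow w (2 * n) = al * w + be) ->
  n = 2^-1 /\ a = 0.
Proof.
move=> n0 b0 oU [w0 Uw0] d2 d1 H.
have [[w1 Uw1 w10]|Uneg] := pselect (exists2 w, U w & 0 < w).
  apply: (@powR_affine_gt0 (U `&` [set w | 0 < w]) n a b al be) => //.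
  - by apply: openI => //; exact: open_gt.
  - by exists w1.
  - by move=> w [].
  - by move=> w [Uw w0']; rewrite -!rpow_gt0// H.
(* On the negative half-line the exponents in use are integral, and w -> -w
   reduces to the previous case. *)
have [w1 Uw1 w10] := open_lt_ex oU Uw0.
have {}w10 : w1 < 0.
  by apply: lt_le_trans w10 _; rewrite leNgt; apply/negP => ?; apply: Uneg; exists w0.
(* A negative base leaves only the natural exponents in [rpow_defined]; [w0] itself might be 0,
   hence the passage to [w1]. *)
have nat2 : 2 * n \is a Num.nat by have [] := d2 _ Uw1 => //; rewrite ltNge ltW.
have nat1 : a != 0 -> n \is a Num.nat.
  by move=> /d1/(_ _ Uw1)[] //; rewrite ltNge ltW.
have rpowN r (w : R) : r \is a Num.nat -> 0 < w ->
    rpow (- w) r = (-1) ^+ Num.truncn r * w `^ r.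
  by move=> rN w0'; rewrite -(rpow_gt0 _ w0') /rpow rN -exprMn mulN1r.
have s0 (r : R) : (-1) ^+ Num.truncn r != 0 :> R by rewrite expf_neq0// oppr_eq0 oner_eq0.
have [] // := @powR_affine_gt0 (-%R @^-1` U `&` [set w | 0 < w]) n
  ((-1) ^+ Num.truncn n * a) ((-1) ^+ Num.truncn (2 * n) * b) (- al) be.
- by rewrite mulf_neq0.
- apply: openI; last exact: open_gt.
  by apply: open_comp => // x _; exact: opp_continuous.
- by exists (- w1); split; rewrite /= ?opprK// oppr_gt0.
- by move=> w [].
- move=> w [Uw w0']; have := H _ Uw; rewrite (rpowN _ _ nat2)//.
  have -> : a * rpow (- w) n = (-1) ^+ Num.truncn n * a * w `^ n.
    (* For a = 0 the exponent n need not be natural (n = 1/2 is possible), and the term vanishes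
       anyway. *)
    have [->|a0] := eqVneq a 0; first by rewrite mulr0 !mul0r.
    by rewrite rpowN ?nat1// mulrA [a * _]mulrC.
  by rewrite mulrN -mulNr => <-; ring.
move=> -> /eqP; rewrite mulf_eq0 (negPf (s0 _))/= => /eqP ->; by [].
Qed.

(** * Antiderivatives and first-order linear equations *)

Lemma smooth_on_antiderivative I f g : open I -> smooth_on I f ->
  antiderivative_on I f g -> smooth_on I g.
Proof.
move=> oI sf df; apply/smooth_onP; split=> [x Ix|v].
  by apply/derivable1_diffP; have := df _ Ix; move=> ?; exact: ex_derive.
apply: smooth_gen_smooth => //.
apply: (sgen_eq _ (sgen_mul (sgen_cst I v) (sgen_smooth sf))) => x Ix /=.
have dg : derivable g x 1 by have := df _ Ix; move=> ?; exact: ex_derive.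
rewrite deriveE; last exact/derivable1_diffP.
by rewrite deriv1E// derive1E; have [_ ->] := df _ Ix.
Qed.

(** The fundamental theorem is applied on compact segments, while [I] may be unbounded and [f]
    unbounded near its ends; local primitives are therefore glued. *)
Lemma antiderivative_exists I f : open_interval I ->
  (forall x, I x -> {for x, continuous f}) ->
  exists P, antiderivative_on I f P.
Proof.
move=> [oI iI [t0 It0]] cf.
(* The segment has both t0 and t in its interior, and its primitive is normalized to vanish at t0,
   so that primitives belonging to different t can be compared. *)
have loc t : I t -> exists2 ab : R * R, I ab.1 /\ I ab.2 &
    [/\ ab.1 < t0 < ab.2, ab.1 < t < ab.2 &
    exists G : R -> R, G t0 = 0 /\
      antiderivative_on [set s | ab.1 < s < ab.2] f G].
  move=> It.
  have [a Ia [at0 at_]] : exists2 a, I a & a < t0 /\ a < t.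
    have [a Ia] : exists2 a, I a & a < Num.min t0 t.
      by apply: open_lt_ex => //; rewrite /Num.min; case: ifP.
    by rewrite lt_min => /andP[]; exists a.
  have [b Ib [bt0 bt]] : exists2 b, I b & t0 < b /\ t < b.
    have [b Ib] : exists2 b, I b & Num.max t0 t < b.
      by apply: open_gt_ex => //; rewrite /Num.max; case: ifP.
    by rewrite gt_max => /andP[]; exists b.
  exists (a, b) => //; split; rewrite /= ?at0 ?at_ ?bt0 ?bt//.
  have sub x : x \in `[a, b] -> I x by rewrite in_itv/=; exact: iI.
  have fi : lebesgue_measure.-integrable `[a, b] (EFin \o f).
    apply: continuous_compact_integrable; first exact: segment_compact.
    by apply: continuous_in_subspaceT => x /set_mem/sub/cf.
  pose F x := (\int[lebesgue_measure]_(s in [set` `[a, x]]) f s)%R.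
  exists (fun x => F x - F t0); split; first by rewrite subrr.
  move=> s /= /andP[as_ sb].
  have Is : I s by apply: sub; rewrite in_itv/= !ltW.
  have [dF F'] := continuous_FTC1_closed sb fi as_ (cf _ Is).
  have dFs : is_derive s (1 : R) F (f s).
    by apply: (DeriveDef dF); rewrite -derive1E.
  apply: (is_derive_eq (is_deriveB dFs (is_derive_cst (F t0) s 1))).
  by rewrite subr0.
have [ab abP] : {ab : R -> R * R & forall t, I t -> I (ab t).1 /\ I (ab t).2 /\
    [/\ (ab t).1 < t0 < (ab t).2, (ab t).1 < t < (ab t).2 &
    exists G : R -> R, G t0 = 0 /\
      antiderivative_on [set s | (ab t).1 < s < (ab t).2] f G]}.
  apply: (@choice _ _ (fun t (ab : R * R) => I t -> I ab.1 /\ I ab.2 /\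
    [/\ ab.1 < t0 < ab.2, ab.1 < t < ab.2 &
    exists G : R -> R, G t0 = 0 /\
      antiderivative_on [set s | ab.1 < s < ab.2] f G])) => t.
  have [It|nIt] := pselect (I t); last by exists (0, 0).
  by have [ab [? ?] ?] := loc _ It; exists ab.
have [G GP] : {G : R -> R -> R & forall t, I t -> G t t0 = 0 /\
      antiderivative_on [set s | (ab t).1 < s < (ab t).2] f (G t)}.
  apply: (@choice _ _ (fun t (G : R -> R) => I t -> G t0 = 0 /\
      antiderivative_on [set s | (ab t).1 < s < (ab t).2] f G)) => t.
  have [It|nIt] := pselect (I t); last by exists (cst 0).
  by have [_ [_ [_ _ [G ?]]]] := abP _ It; exists G.
(* The G t vanish at t0, so they agree on overlaps. *)
exists (fun t => G t t) => t It.
have [Ia [Ib [t0ab tab _]]] := abP _ It.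
have [Gt0 dG] := GP _ It.
apply: near_eq_is_derive (dG t tab); near=> s.
have sab : (ab t).1 < s < (ab t).2 by near: s; exact: near_in_itvoo.
have Is : I s by case/andP: sab => /ltW ? /ltW ?; apply: (iI _ _ Ia Ib); apply/andP.
have [_ [_ [t0ab' sab' _]]] := abP _ Is.
have [Gs0 dG'] := GP _ Is.
pose J := [set r | (ab t).1 < r < (ab t).2] `&` [set r | (ab s).1 < r < (ab s).2].
have iJ : is_interval J.
  by move=> x y [/=/andP[? ?] /andP[? ?]] [/=/andP[? ?] /andP[? ?]] z /andP[? ?];
    split; apply/andP; split; lra.
have dJ x : J x -> is_derive x (1 : R) (fun r => G t r - G s r) 0.
  move=> [xt xs]; apply: is_derive_eq (subrr (f x)).
  exact: is_deriveB (dG x xt) (dG' x xs).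
have := is_derive0_cst iJ dJ (conj sab sab') (conj t0ab t0ab').
by rewrite Gt0 Gs0 subrr => /subr0_eq.
Unshelve. all: by end_near. Qed.

(** Integrating factor exp(-P): y exp(-P) and [G] have the same derivative, so their difference is
    the constant c. *)
Lemma linear_ode I (Q P g G y : R -> R) : open_interval I ->
    antiderivative_on I Q P ->
    antiderivative_on I (fun t => g t * expR (- P t)) G ->
    (forall t, I t -> is_derive t (1 : R) y (Q t * y t + g t)) ->
  exists c, forall t, I t -> y t = (c + G t) * expR (P t).
Proof.
move=> [oI iI [t0 It0]] dP dG dy.
pose z t := y t * expR (- P t) - G t.
have dz t : I t -> is_derive t (1 : R) z 0.
  move=> It.
  have dE := is_derive_expR_comp (is_deriveN (dP _ It)).
  have := is_deriveB (is_deriveM (dy _ It) dE) (dG _ It).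
  move=> H; apply: (is_derive_eq H).
  set e := expR _; rewrite -[LHS]/(y t * (- Q t * e) + e * (Q t * y t + g t) - g t * e).
  by ring.
exists (z t0) => t It; rewrite (is_derive0_cst iI dz It0 It) /z subrK -mulrA.
by rewrite -expRD addNr expR0 mulr1.
Qed.

Lemma linear_ode_homo I (Q P y : R -> R) : open_interval I ->
    antiderivative_on I Q P ->
    (forall t, I t -> is_derive t (1 : R) y (Q t * y t)) ->
  exists c, forall t, I t -> y t = c * expR (P t).
Proof.
move=> oI dP dy; have [t It|t It|c cE] := @linear_ode I Q P (cst 0) (cst 0) y oI dP.
- rewrite /= mul0r; exact: is_derive_cst.
- by rewrite addr0; exact: dy.
by exists c => t It; rewrite cE//= addr0.
Qed.

End RealAnalysis.

(** * Total derivatives on the jet space *)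

Section JetCalculus.
Context {R : realType}.
Implicit Types (f g : jet R -> R) (J : jet R) (a : nat * nat).

Lemma set_coord_id (w : nat -> nat -> R) i j : set_coord w i j (w i j) = w.
Proof.
apply/funext => k; apply/funext => l; rewrite /set_coord.
by case: andP => // -[/eqP -> /eqP ->].
Qed.

(** Restrictions to coordinate lines, named so that one-variable rules for sums and products apply
    to [pd_x], [pd_u] and [pd_v]. *)
Definition line_x f J (s : R) : R := f (Jet (jt J) s (ju J) (jv J)).
Definition line_u f J a (s : R) : R :=
  f (Jet (jt J) (jx J) (set_coord (ju J) a.1 a.2 s) (jv J)).
Definition line_v f J a (s : R) : R :=
  f (Jet (jt J) (jx J) (ju J) (set_coord (jv J) a.1 a.2 s)).

Lemma line_xE f J : line_x f J (jx J) = f J.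
Proof. by case: J. Qed.

Lemma line_uE f J a : line_u f J a (ju J a.1 a.2) = f J.
Proof. by rewrite /line_u set_coord_id; case: J. Qed.

Lemma line_vE f J a : line_v f J a (jv J a.1 a.2) = f J.
Proof. by rewrite /line_v set_coord_id; case: J. Qed.

(** A condition at the single jet [J]: it suffices to turn the sum in a total derivative at [J] into
    a finite one. *)
Definition supported f J (r : seq (nat * nat)) : Prop :=
  forall a, a \notin r -> pd_u a.1 a.2 f J = 0 /\ pd_v a.1 a.2 f J = 0.

Lemma fsum_seq (F : nat * nat -> R) (r : seq (nat * nat)) :
  uniq r -> (forall a, a \notin r -> F a = 0) ->
  \sum_(a \in [set: nat * nat]) F a = \sum_(a <- r) F a.
Proof.
move=> ur F0; rewrite (@fsbig_seq _ _ _ _ r F ur).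
apply/esym/fsbig_widen => // a [_ /= ar].
by apply: F0; apply/negP.
Qed.

Lemma Dx_supported f J r : uniq r -> supported f J r ->
  Dx f J = pd_x f J + \sum_(a <- r) (ju J a.1 a.2.+1 * pd_u a.1 a.2 f J +
                                     jv J a.1 a.2.+1 * pd_v a.1 a.2 f J).
Proof.
by move=> ur fr; rewrite /Dx (fsum_seq ur)// => a /fr[-> ->]; rewrite !mulr0 addr0.
Qed.

Lemma Dt_supported f J r : uniq r -> supported f J r ->
  Dt f J = pd_t f J + \sum_(a <- r) (ju J a.1.+1 a.2 * pd_u a.1 a.2 f J +
                                     jv J a.1.+1 a.2 * pd_v a.1 a.2 f J).
Proof.
by move=> ur fr; rewrite /Dt (fsum_seq ur)// => a /fr[-> ->]; rewrite !mulr0 addr0.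
Qed.

(** What makes [Dx] additive and a derivation at [J]. The finite support matters because a sum with
    infinite support is 0 by convention, which would break additivity. *)
Definition Dx_regular f J : Prop :=
  [/\ derivable (line_x f J) (jx J) (1 : R),
      forall a, derivable (line_u f J a) (ju J a.1 a.2) (1 : R),
      forall a, derivable (line_v f J a) (jv J a.1 a.2) (1 : R) &
      exists r, supported f J r].

Lemma supported_cat f g J r s : supported f J r -> supported g J s ->
  supported f J (undup (r ++ s)) /\ supported g J (undup (r ++ s)).
Proof.
move=> fr gs; split=> a; rewrite mem_undup mem_cat negb_or => /andP[].
  by move=> /fr.
by move=> _ /gs.
Qed.

(** * Sum and product rules for [Dx] *)

Lemma pd_xD f g J : Dx_regular f J -> Dx_regular g J ->
  pd_x (fun K => f K + g K) J = pd_x f J + pd_x g J.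
Proof. by move=> [df _ _ _] [dg _ _ _]; rewrite /pd_x !derive1E -(deriveD df dg). Qed.
Lemma pd_uD f g J i j : Dx_regular f J -> Dx_regular g J ->
  pd_u i j (fun K => f K + g K) J = pd_u i j f J + pd_u i j g J.
Proof.
move=> [_ df _ _] [_ dg _ _].
by rewrite /pd_u !derive1E -(deriveD (df (i, j)) (dg (i, j))).
Qed.
Lemma pd_vD f g J i j : Dx_regular f J -> Dx_regular g J ->
  pd_v i j (fun K => f K + g K) J = pd_v i j f J + pd_v i j g J.
Proof.
move=> [_ _ df _] [_ _ dg _].
by rewrite /pd_v !derive1E -(deriveD (df (i, j)) (dg (i, j))).
Qed.

Lemma pd_xM f g J : Dx_regular f J -> Dx_regular g J ->
  pd_x (fun K => f K * g K) J = f J * pd_x g J + g J * pd_x f J.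
Proof.
move=> [df _ _ _] [dg _ _ _]; rewrite /pd_x !derive1E.
by have := deriveM df dg; rewrite !line_xE.
Qed.
Lemma pd_uM f g J i j : Dx_regular f J -> Dx_regular g J ->
  pd_u i j (fun K => f K * g K) J = f J * pd_u i j g J + g J * pd_u i j f J.
Proof.
move=> [_ df _ _] [_ dg _ _]; rewrite /pd_u !derive1E.
by have := deriveM (df (i, j)) (dg (i, j)); rewrite !line_uE.
Qed.
Lemma pd_vM f g J i j : Dx_regular f J -> Dx_regular g J ->
  pd_v i j (fun K => f K * g K) J = f J * pd_v i j g J + g J * pd_v i j f J.
Proof.
move=> [_ _ df _] [_ _ dg _]; rewrite /pd_v !derive1E.
by have := deriveM (df (i, j)) (dg (i, j)); rewrite !line_vE.
Qed.

Lemma Dx_regularD f g J : Dx_regular f J -> Dx_regular g J ->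
  Dx_regular (fun K => f K + g K) J.
Proof.
move=> rf rg; have [dfx dfu dfv [r fr]] := rf; have [dgx dgu dgv [s gs]] := rg.
split=> [|a|a|]; [exact: (derivableD dfx dgx)|exact: (derivableD (dfu a) (dgu a))|
  exact: (derivableD (dfv a) (dgv a))|].
have [{}fr {}gs] := supported_cat fr gs.
exists (undup (r ++ s)) => a ar; rewrite pd_uD// pd_vD//.
by have [-> ->] := fr a ar; have [-> ->] := gs a ar; rewrite addr0.
Qed.

Lemma Dx_regularM f g J : Dx_regular f J -> Dx_regular g J ->
  Dx_regular (fun K => f K * g K) J.
Proof.
move=> rf rg; have [dfx dfu dfv [r fr]] := rf; have [dgx dgu dgv [s gs]] := rg.
split=> [|a|a|]; [exact: (derivableM dfx dgx)|exact: (derivableM (dfu a) (dgu a))|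
  exact: (derivableM (dfv a) (dgv a))|].
have [{}fr {}gs] := supported_cat fr gs.
exists (undup (r ++ s)) => a ar; rewrite pd_uM// pd_vM//.
by have [-> ->] := fr a ar; have [-> ->] := gs a ar; rewrite !mulr0 addr0.
Qed.

Lemma DxD f g J : Dx_regular f J -> Dx_regular g J ->
  Dx (fun K => f K + g K) J = Dx f J + Dx g J.
Proof.
move=> rf rg; have [_ _ _ [r fr]] := rf; have [_ _ _ [s gs]] := rg.
have [{}fr {}gs] := supported_cat fr gs.
have ur := undup_uniq (r ++ s).
rewrite (Dx_supported ur fr) (Dx_supported ur gs) (Dx_supported ur) => [|a ar].
  rewrite pd_xD// addrACA -big_split/=; congr (_ + _).
  by apply: eq_bigr => a _; rewrite pd_uD// pd_vD// !mulrDr addrACA.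
rewrite pd_uD// pd_vD//.
by have [-> ->] := fr a ar; have [-> ->] := gs a ar; rewrite addr0.
Qed.

Lemma DxM f g J : Dx_regular f J -> Dx_regular g J ->
  Dx (fun K => f K * g K) J = f J * Dx g J + g J * Dx f J.
Proof.
move=> rf rg; have [_ _ _ [r fr]] := rf; have [_ _ _ [s gs]] := rg.
have [{}fr {}gs] := supported_cat fr gs.
have ur := undup_uniq (r ++ s).
rewrite (Dx_supported ur fr) (Dx_supported ur gs) (Dx_supported ur) => [|a ar].
  rewrite pd_xM// !mulrDr addrACA !mulr_sumr -big_split/=; congr (_ + _).
  by apply: eq_bigr => a _; rewrite pd_uM// pd_vM//; ring.
rewrite pd_uM// pd_vM//.
by have [-> ->] := fr a ar; have [-> ->] := gs a ar; rewrite !mulr0 addr0.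
Qed.

(** [v F] is affine in each of u_t, u_x and u_xxx; this reads off the coefficients. *)
Lemma derive1_affine (c d s : R) : derive1 (fun s => c * s + d) s = c.
Proof.
rewrite derive1E.
have [_ ->] := is_deriveD (is_deriveZ c (is_derive_id s 1)) (is_derive_cst d s 1).
by rewrite addr0 -[LHS]/(c * 1) mulr1.
Qed.

Lemma line_u_ju J a i j :
  line_u (fun K => ju K i j) J a = if (i, j) == a then id else cst (ju J i j).
Proof.
apply/funext => s; case: a => k l.
by rewrite /line_u/= /set_coord xpair_eqE; case: ifP.
Qed.

Lemma line_v_jv J a i j :
  line_v (fun K => jv K i j) J a = if (i, j) == a then id else cst (jv J i j).
Proof.
apply/funext => s; case: a => k l.
by rewrite /line_v/= /set_coord xpair_eqE; case: ifP.
Qed.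

Lemma pd_u_ju J i j k l :
  pd_u k l (fun K => ju K i j) J = ((i, j) == (k, l))%:R.
Proof.
rewrite /pd_u -[X in derive1 X]/(line_u (fun K => ju K i j) J (k, l)).
rewrite line_u_ju.
by case: eqP => _; [exact: derive1_id|exact: derive1_cst].
Qed.

Lemma pd_v_jv J i j k l :
  pd_v k l (fun K => jv K i j) J = ((i, j) == (k, l))%:R.
Proof.
rewrite /pd_v -[X in derive1 X]/(line_v (fun K => jv K i j) J (k, l)).
rewrite line_v_jv.
by case: eqP => _; [exact: derive1_id|exact: derive1_cst].
Qed.

Lemma supported_ju J i j : supported (fun K => ju K i j) J [:: (i, j)].
Proof.
move=> [k l]; rewrite inE => /negPf ne; rewrite pd_u_ju eq_sym ne; split=> //.
exact: derive1_cst.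
Qed.

Lemma supported_jv J i j : supported (fun K => jv K i j) J [:: (i, j)].
Proof.
move=> [k l]; rewrite inE => /negPf ne; rewrite pd_v_jv eq_sym ne; split=> //.
exact: derive1_cst.
Qed.

Lemma Dx_regular_ju J i j : Dx_regular (fun K => ju K i j) J.
Proof.
split=> [|a|a|]; [exact: derivable_cst| |exact: derivable_cst|
  by exists [:: (i, j)]; exact: supported_ju].
by rewrite line_u_ju; case: ifP => _; [exact: derivable_id|exact: derivable_cst].
Qed.

Lemma Dx_regular_jv J i j : Dx_regular (fun K => jv K i j) J.
Proof.
split=> [|a|a|]; [exact: derivable_cst|exact: derivable_cst| |
  by exists [:: (i, j)]; exact: supported_jv].
by rewrite line_v_jv; case: ifP => _; [exact: derivable_id|exact: derivable_cst].
Qed.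

Lemma Dx_ju i j : Dx (fun J => ju J i j) = fun J => ju J i j.+1.
Proof.
apply/funext => J; rewrite (Dx_supported _ (@supported_ju J i j))// big_seq1/=.
rewrite pd_u_ju eqxx mulr1 /pd_x /pd_v !derive1_cst mulr0 add0r addr0//.
Qed.

Lemma Dx_jv i j : Dx (fun J => jv J i j) = fun J => jv J i j.+1.
Proof.
apply/funext => J; rewrite (Dx_supported _ (@supported_jv J i j))// big_seq1/=.
by rewrite pd_v_jv eqxx mulr1 /pd_x /pd_u !derive1_cst mulr0 !add0r.
Qed.

Lemma Dt_jv i j : Dt (fun J => jv J i j) = fun J => jv J i.+1 j.
Proof.
apply/funext => J; rewrite (Dt_supported _ (@supported_jv J i j))// big_seq1/=.
by rewrite pd_v_jv eqxx mulr1 /pd_t /pd_u !derive1_cst mulr0 !add0r.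
Qed.

(** Curried counterpart of [lift_txu], so that [flux], functions of t alone and the coordinate x fit
    directly. *)
Definition on_txu (psi : R -> R -> R -> R) : jet R -> R :=
  fun J => psi (jt J) (jx J) (ju J 0%N 0%N).

Lemma supported_txu psi J : supported (on_txu psi) J [:: (0, 0)%N].
Proof.
move=> [k l]; rewrite inE xpair_eqE => /negPf ne; rewrite /pd_u /pd_v /on_txu/=.
by rewrite /set_coord/= ![0%N == _]eq_sym ne !derive1_cst.
Qed.

Lemma Dx_regular_txu psi J :
    derivable (fun s => psi (jt J) s (ju J 0%N 0%N)) (jx J) (1 : R) ->
    derivable (psi (jt J) (jx J)) (ju J 0%N 0%N) (1 : R) ->
  Dx_regular (on_txu psi) J.
Proof.
move=> dx du; split; [exact: dx|case=> k l|move=> a|]; last first.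
- by exists [:: (0, 0)%N]; exact: supported_txu.
- have -> : line_v (on_txu psi) J a = cst (on_txu psi J) by [].
  exact: derivable_cst.
rewrite /line_u /on_txu /= /set_coord/=.
rewrite ![0%N == _]eq_sym.
have [/andP[/eqP -> /eqP ->]|_] := boolP ((k == 0%N) && (l == 0%N)).
  exact: du.
exact: derivable_cst.
Qed.

Lemma Dx_txu psi J dx du :
    is_derive (jx J) (1 : R) (fun s => psi (jt J) s (ju J 0%N 0%N)) dx ->
    is_derive (ju J 0%N 0%N) (1 : R) (psi (jt J) (jx J)) du ->
  Dx (on_txu psi) J = dx + ju J 0%N 1%N * du.
Proof.
move=> [_ <-] [_ <-]; rewrite (Dx_supported _ (@supported_txu psi J))// big_seq1/=.
by rewrite /pd_v /on_txu/= derive1_cst mulr0 addr0 /pd_x /pd_u !derive1E.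
Qed.

Lemma Dt_txu psi J dt du :
    is_derive (jt J) (1 : R) (fun s => psi s (jx J) (ju J 0%N 0%N)) dt ->
    is_derive (ju J 0%N 0%N) (1 : R) (psi (jt J) (jx J)) du ->
  Dt (on_txu psi) J = dt + ju J 1%N 0%N * du.
Proof.
move=> [_ <-] [_ <-]; rewrite (Dt_supported _ (@supported_txu psi J))// big_seq1/=.
by rewrite /pd_v /on_txu/= derive1_cst mulr0 addr0 /pd_t /pd_u !derive1E.
Qed.

Section Locality.
Variables I X U : set R.
Hypotheses (oI : open I) (oX : open X) (oU : open U).

(** [Dx] at a jet uses [f] only near that jet on lines in x and in the u- and v-coordinates. The box
    restricts only x and u along these lines, and openness keeps nearby points inside. This allows
    [Dx] to be iterated on formulas valid only over the box. *)
Lemma eq_on_jet_box_Dx f g :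
    (forall J, jet_box I X U J -> f J = g J) ->
  forall J, jet_box I X U J -> Dx f J = Dx g J.
Proof.
move=> fg J JB; have [/= It Xx Uu] := JB; congr (_ + _).
  rewrite /pd_x !derive1E; apply: near_eq_derive; near=> s; apply: fg; split=> //=.
  by near: s; exact: open_nbhs_nbhs.
apply: eq_fsbigr => -[k l] _ /=; congr (_ * _ + _ * _).
  rewrite /pd_u !derive1E; apply: near_eq_derive.
  have [kl|kl] := eqVneq (k, l) (0, 0)%N.
    case: kl => -> ->; near=> s; apply: fg; split=> //=.
    by near: s; exact: open_nbhs_nbhs.
  near=> s; apply: fg; split=> //=.
  by rewrite /set_coord/= ![0%N == _]eq_sym -xpair_eqE (negPf kl).
by rewrite /pd_v !derive1E; apply: near_eq_derive; near=> s; apply: fg; split.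
Unshelve. all: by end_near. Qed.

End Locality.

End JetCalculus.

(** * The adjoint equation and the substitution v = phi *)

Section AdjointEquation.
Context {R : realType}.
Variables (n : R) (A Q : R -> R) (I X U : set R).

Definition flux (t u : R) : R := A t * rpow u n + rpow u (2 * n).

(** Where A(t) = 0 the power u^n may be undefined, so that case drops the term before
    differentiating. *)
Lemma derivable_flux t u : powers_defined n A I U -> I t -> U u ->
  derivable (flux t) u (1 : R).
Proof.
move=> hpow It Uu; have [d2 d1] := hpow u Uu.
apply: derivableD; last exact: derivable_rpow.
have [->|At] := eqVneq (A t) 0.
  have -> : (fun s => 0 * rpow s n) = cst 0 by apply/funext => s; rewrite mul0r.
  exact: derivable_cst.
have dn : derivable (fun w => rpow w n) u (1 : R).
  by apply/derivable_rpow/d1; exists t.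
exact: (derivableM (derivable_cst (A t) u 1) dn).
Qed.

Let vF : jet R -> R := fun J => jv J 0%N 0%N * gkdv n A Q J.

Lemma pd_u10_gkdv : pd_u 1 0 vF = fun J => jv J 0%N 0%N.
Proof.
apply/funext => J; rewrite /pd_u /vF /gkdv/=.
rewrite -[RHS](derive1_affine _ (jv J 0%N 0%N * (flux (jt J) (ju J 0%N 0%N) *
  ju J 0%N 1%N + ju J 0%N 3%N + Q (jt J) * ju J 0%N 0%N)) (ju J 1%N 0%N)).
congr (derive1 _ _); apply/funext => s; rewrite /set_coord/= /flux; ring.
Qed.

Lemma pd_u01_gkdv :
  pd_u 0 1 vF = fun J => jv J 0%N 0%N * flux (jt J) (ju J 0%N 0%N).
Proof.
apply/funext => J; rewrite /pd_u /vF /gkdv/=.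
rewrite -[RHS](derive1_affine _ (jv J 0%N 0%N * (ju J 1%N 0%N +
  ju J 0%N 3%N + Q (jt J) * ju J 0%N 0%N)) (ju J 0%N 1%N)).
congr (derive1 _ _); apply/funext => s; rewrite /set_coord/= /flux; ring.
Qed.

Lemma pd_u03_gkdv : pd_u 0 3 vF = fun J => jv J 0%N 0%N.
Proof.
apply/funext => J; rewrite /pd_u /vF /gkdv/=.
rewrite -[RHS](derive1_affine _ (jv J 0%N 0%N * (ju J 1%N 0%N +
  flux (jt J) (ju J 0%N 0%N) * ju J 0%N 1%N + Q (jt J) * ju J 0%N 0%N))
  (ju J 0%N 3%N)).
congr (derive1 _ _); apply/funext => s; rewrite /set_coord/= /flux; ring.
Qed.

Lemma pd_u00_gkdv J : derivable (flux (jt J)) (ju J 0%N 0%N) (1 : R) ->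
  pd_u 0 0 vF J = jv J 0%N 0%N *
    (derive1 (flux (jt J)) (ju J 0%N 0%N) * ju J 0%N 1%N + Q (jt J)).
Proof.
move=> df; rewrite /pd_u /vF /gkdv/= /set_coord/=.
set v := jv J 0%N 0%N; set h := flux (jt J) in df *.
have -> : (fun s => v * (ju J 1 0 + A (jt J) * rpow s n * ju J 0 1 +
      rpow s (2 * n) * ju J 0 1 + ju J 0 3 + Q (jt J) * s)) =
    (fun s => v * ju J 0%N 1%N * h s + 
      (v * Q (jt J) * s + v * (ju J 1%N 0%N + ju J 0%N 3%N))).
  by apply/funext => s; rewrite /h /flux; ring.
have da := is_deriveD (is_deriveZ (v * Q (jt J)) (is_derive_id (ju J 0%N 0%N) 1))
  (is_derive_cst (v * (ju J 1%N 0%N + ju J 0%N 3%N)) (ju J 0%N 0%N) 1).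
have := is_deriveD (is_deriveZ (v * ju J 0%N 1%N) (derivableP df)) da.
move=> [_]; rewrite derive1E => ->; rewrite derive1E addr0.
rewrite -[LHS]/(v * ju J 0%N 1%N * 'D_1 h (ju J 0%N 0%N) + v * Q (jt J) * 1).
by ring.
Qed.

Lemma pd_u_gkdv_eq0 a : a \notin [:: (0, 0); (1, 0); (0, 1); (0, 3)]%N ->
  pd_u a.1 a.2 vF = fun=> 0.
Proof.
case: a => k l; rewrite !inE !negb_or => /and4P[n00 n10 n01 n03].
apply/funext => J; rewrite /pd_u /vF /gkdv/= /set_coord/= -!xpair_eqE.
rewrite ![(_, _) == (k, l)]eq_sym (negPf n00) (negPf n10) (negPf n01) (negPf n03).
exact: derive1_cst.
Qed.

(** Removes from the variational derivative all terms outside the four coordinates on which [v F]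
    depends. *)
Lemma iter_Dt_Dx0 k l : iter k (@Dt R) (iter l (@Dx R) (fun=> 0)) = fun=> 0.
Proof.
have s0 J : supported (fun=> 0 : R) J [::].
  by move=> a _; split; exact: derive1_cst.
have -> : iter l (@Dx R) (fun=> 0) = fun=> 0.
  elim: l => // l IH; rewrite iterS IH; apply/funext => J.
  by rewrite (Dx_supported _ (s0 J))// big_nil addr0; exact: derive1_cst.
elim: k => // k IH; rewrite iterS IH; apply/funext => J.
by rewrite (Dt_supported _ (s0 J))// big_nil addr0; exact: derive1_cst.
Qed.

Hypothesis hpow : powers_defined n A I U.

(** The term v h_u u_x coming from the derivative in u cancels against the one in D_x(v h), so no
    derivative of h survives. *)
Lemma adjoint_gkdv J : jet_box I X U J ->
  adjoint (gkdv n A Q) J = Q (jt J) * jv J 0%N 0%N - jv J 1%N 0%N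
    - flux (jt J) (ju J 0%N 0%N) * jv J 0%N 1%N - jv J 0%N 3%N.
Proof.
move=> [/= It _ Uu]; have df := derivable_flux hpow It Uu.
rewrite /adjoint /var_deriv.
rewrite (@fsum_seq _ _ [:: (0, 0); (1, 0); (0, 1); (0, 3)]%N)//; last first.
  by move=> a /pd_u_gkdv_eq0; rewrite /vF => ->; rewrite iter_Dt_Dx0 mulr0.
rewrite !big_cons big_nil -/vF /= pd_u00_gkdv// pd_u10_gkdv pd_u01_gkdv pd_u03_gkdv.
rewrite !Dx_jv Dt_jv.
have rf : Dx_regular (on_txu (fun t _ u => flux t u)) J.
  apply: Dx_regular_txu; last exact: df.
  exact: (derivable_cst (flux (jt J) (ju J 0%N 0%N)) (jx J) 1).
rewrite (DxM (Dx_regular_jv J 0 0) rf) Dx_jv.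
rewrite (@Dx_txu _ (fun t _ u => flux t u) J _ _
  (is_derive_cst (flux (jt J) (ju J 0%N 0%N)) _ _) (derivableP df)) derive1E /on_txu.
by rewrite add0n; ring.
Qed.

(** The substitution leaves t, x and u unchanged, so the substituted jet still lies over the box. *)
Lemma subst_adjoint_gkdv (phi : R * R * R -> R) J : jet_box I X U J ->
  subst_v phi (adjoint (gkdv n A Q)) J =
    Q (jt J) * lift_txu phi J - Dt (lift_txu phi) J
    - flux (jt J) (ju J 0%N 0%N) * Dx (lift_txu phi) J
    - Dx (Dx (Dx (lift_txu phi))) J.
Proof. by move=> JB; rewrite /subst_v adjoint_gkdv. Qed.

End AdjointEquation.

(** * Partial derivatives of phi and the chain rule *)

Section Substitution.
Context {R : realType}.
Implicit Types (phi : R * R * R -> R).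

(** Taken as directional derivatives so that smoothness of phi passes to them at once. *)
Definition part_t phi := 'D_((1, 0, 0) : R * R * R) phi.
Definition part_x phi := 'D_((0, 1, 0) : R * R * R) phi.
Definition part_u phi := 'D_((0, 0, 1) : R * R * R) phi.

(** The difference quotients of [g] at [s] and of [phi] at [p] along [v] are the same function of
    h. *)
Lemma is_derive_line (V : normedModType R) (phi : V -> R) (g : R -> R) (p v : V) s :
    differentiable phi p -> (forall h, g (h + s) = phi (h *: v + p)) ->
  is_derive s (1 : R) g ('D_v phi p).
Proof.
move=> dphi gE; have {}dphi : derivable phi p v by exact: diff_derivable.
have E : (fun h : R => h^-1 *: ((phi \o shift p) (h *: v) - phi p)) =
         (fun h : R => h^-1 *: ((g \o shift s) (h *: (1 : R)) - g s)).
  apply/funext => h; rewrite /= -gE -[h *: 1]/(h * 1) mulr1.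
  by have := gE 0; rewrite scale0r !add0r => ->.
by apply: DeriveDef; rewrite /derivable /derive -E.
Qed.

Variables I X U : set R.
Hypotheses (oI : open I) (oX : open X) (oU : open U).
Local Notation B := (box I X U).
Local Notation JB := (jet_box I X U).

Lemma open_box : open B.
Proof.
have -> : B = [set p : R * R * R | I p.1.1] `&` [set p | X p.1.2] `&` [set p | U p.2].
  by apply/seteqP; split=> p /=; [case|case=> -[]].
apply: openI; first apply: openI.
- apply: (@open_comp _ _ (fun p : R * R * R => p.1.1)) => // p _.
  by apply: cvg_comp; exact: cvg_fst.
- apply: (@open_comp _ _ (fun p : R * R * R => p.1.2)) => // p _.
  by apply: cvg_comp; [exact: cvg_fst|exact: cvg_snd].
- by apply: (@open_comp _ _ snd) => // p _; exact: cvg_snd.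
Qed.

Section Partials.
Variable phi : R * R * R -> R.
Hypothesis sphi : smooth_on B phi.

Lemma smooth_part_x : smooth_on B (part_x phi).
Proof. exact: smooth_on_derive. Qed.
Lemma smooth_part_u : smooth_on B (part_u phi).
Proof. exact: smooth_on_derive. Qed.

Variables t x u : R.
Hypothesis Bp : B (t, x, u).

Lemma is_derive_part_t :
  is_derive t (1 : R) (fun s => phi (s, x, u)) (part_t phi (t, x, u)).
Proof.
apply: is_derive_line; first exact: smooth_on_differentiable sphi Bp.
by move=> h; congr (phi (_, _, _)); rewrite /= -[h *: _]/(h * _) ?mulr1 ?mulr0 ?add0r.
Qed.

Lemma is_derive_part_x :
  is_derive x (1 : R) (fun s => phi (t, s, u)) (part_x phi (t, x, u)).
Proof.
apply: is_derive_line; first exact: smooth_on_differentiable sphi Bp.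
by move=> h; congr (phi (_, _, _)); rewrite /= -[h *: _]/(h * _) ?mulr1 ?mulr0 ?add0r.
Qed.

Lemma is_derive_part_u :
  is_derive u (1 : R) (fun s => phi (t, x, s)) (part_u phi (t, x, u)).
Proof.
apply: is_derive_line; first exact: smooth_on_differentiable sphi Bp.
by move=> h; congr (phi (_, _, _)); rewrite /= -[h *: _]/(h * _) ?mulr1 ?mulr0 ?add0r.
Qed.

End Partials.

Lemma Dx_regular_lift phi J : smooth_on B phi -> JB J -> Dx_regular (lift_txu phi) J.
Proof.
move=> sphi JBJ; apply: (@Dx_regular_txu _ (fun t x u => phi (t, x, u))).
  by have := is_derive_part_x sphi JBJ; move=> ?; exact: ex_derive.
by have := is_derive_part_u sphi JBJ; move=> ?; exact: ex_derive.
Qed.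

Lemma Dx_lift phi J : smooth_on B phi -> JB J ->
  Dx (lift_txu phi) J = lift_txu (part_x phi) J + ju J 0%N 1%N * lift_txu (part_u phi) J.
Proof.
move=> sphi JBJ.
exact: (@Dx_txu _ (fun t x u => phi (t, x, u)) J _ _
  (is_derive_part_x sphi JBJ) (is_derive_part_u sphi JBJ)).
Qed.

Lemma Dt_lift phi J : smooth_on B phi -> JB J ->
  Dt (lift_txu phi) J = lift_txu (part_t phi) J + ju J 1%N 0%N * lift_txu (part_u phi) J.
Proof.
move=> sphi JBJ.
exact: (@Dt_txu _ (fun t x u => phi (t, x, u)) J _ _
  (is_derive_part_t sphi JBJ) (is_derive_part_u sphi JBJ)).
Qed.

End Substitution.

(** * Determining equations *)

(* The arithmetic tactics would compare distinct partial derivatives by unfolding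
   them down to limits. *)
Ltac abstract_partials := repeat match goal with
  | |- context [lift_txu ?p ?J] => generalize (lift_txu p J); intro
  | |- context [part_t ?p ?z] => generalize (part_t p z); intro
  | |- context [part_x ?p ?z] => generalize (part_x p z); intro
  | |- context [part_u ?p ?z] => generalize (part_u p z); intro
  end.

Section SelfAdjointness.
Context {R : realType}.

(** Pairs the value with the regularity that the sum and product rules require, so that [Dx] of a
    compound expression is obtained by nesting these rules. *)
Definition has_Dx (f : jet R -> R) J d := Dx_regular f J /\ Dx f J = d.

Lemma has_DxD f g J df dg : has_Dx f J df -> has_Dx g J dg ->
  has_Dx (fun K => f K + g K) J (df + dg).
Proof. by move=> [rf <-] [rg <-]; split; [exact: Dx_regularD|exact: DxD]. Qed.

Lemma has_DxM f g J df dg : has_Dx f J df -> has_Dx g J dg ->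
  has_Dx (fun K => f K * g K) J (f J * dg + g J * df).
Proof. by move=> [rf <-] [rg <-]; split; [exact: Dx_regularM|exact: DxM]. Qed.

Lemma has_Dx_ju J i j : has_Dx (fun K => ju K i j) J (ju J i j.+1).
Proof. by split; [exact: Dx_regular_ju|rewrite Dx_ju]. Qed.

(** [Dx] never differentiates in t, so [p] is arbitrary here. *)
Lemma has_Dx_jt (p : R -> R) J : has_Dx (fun K => p (jt K)) J 0.
Proof.
have dp (y : R) : is_derive y (1 : R) (fun=> p (jt J)) 0.
  exact: (is_derive_cst (p (jt J))).
split.
  apply: (@Dx_regular_txu _ (fun t _ _ => p t)).
    by have := dp (jx J); move=> [].
  by have := dp (ju J 0%N 0%N); move=> [].
rewrite -[Dx _ _]/(Dx (on_txu (fun t _ _ => p t)) J).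
rewrite (@Dx_txu _ (fun t _ _ => p t) J 0 0 (dp _) (dp _)).
by rewrite mulr0 addr0.
Qed.

Lemma has_Dx_jx J : has_Dx (@jx R) J 1.
Proof.
have d0 : is_derive (ju J 0%N 0%N) (1 : R) (fun=> jx J) 0.
  exact: (is_derive_cst (jx J)).
have d1 := is_derive_id (jx J) (1 : R).
split.
  apply: (@Dx_regular_txu _ (fun _ x _ => x)); first by case: d1.
  by case: d0.
rewrite -[Dx _ _]/(Dx (on_txu (fun _ x _ => x)) J).
by rewrite (@Dx_txu _ (fun _ x _ => x) J 1 0 d1 d0) mulr0 addr0.
Qed.

Variables (n : R) (A Q : R -> R) (I X U : set R).
Hypotheses (n0 : 0 < n) (hI : open_interval I) (hX : open_interval X)
  (hU : open_interval U) (hpow : powers_defined n A I U).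

Let oI : open I. Proof. by case: hI. Qed.
Let oX : open X. Proof. by case: hX. Qed.
Let oU : open U. Proof. by case: hU. Qed.
Let iX : is_interval X. Proof. by case: hX. Qed.
Let iU : is_interval U. Proof. by case: hU. Qed.
Local Notation B := (box I X U).
Local Notation JB := (jet_box I X U).
Local Notation h := (flux n A).

Lemma Dx_eq_on f g J : JB J -> (forall K, JB K -> Dx f K = g K) ->
  Dx (Dx f) J = Dx g J.
Proof. by move=> JBJ fg; exact: (eq_on_jet_box_Dx oX oU fg JBJ). Qed.

Lemma flux_affine t (al be : R) : I t -> (forall u, U u -> h t u = al * u + be) ->
  n = 2^-1 /\ A t = 0.
Proof.
move=> It H; case: hU => _ _ U0.
apply: (@rpow_affine R U n (A t) 1 al be n0 _ oU) => //.
- by move=> u Uu; have [] := hpow Uu.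
- by move=> At u Uu; have [_] := hpow Uu; apply; exists t.
- by move=> u Uu; rewrite mul1r -H.
Qed.

Lemma flux_half t u : n = 2^-1 -> A t = 0 -> h t u = u.
Proof.
move=> -> At; rewrite /flux At mul0r add0r mulfV ?pnatr_eq0//.
by rewrite /rpow rpred1 truncn1 expr1.
Qed.

(** A constant is affine with slope 0, so a constant flux would force n = 1/2 and A(t) = 0; but then
    the flux is u itself. *)
Lemma flux_neq t u0 : I t -> U u0 -> exists2 u, U u & h t u != h t u0.
Proof.
move=> It Uu0; apply: contrapT => /forall2NP H.
have cst_h u : U u -> h t u = h t u0.
  by move=> Uu; case: (H u) => // /negP; rewrite negbK => /eqP.
have [nE At] : n = 2^-1 /\ A t = 0.
  by apply: (flux_affine It (al := 0) (be := h t u0)) => u /cst_h ->; rewrite mul0r add0r.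
have [u1 Uu1] := open_gt_ex oU Uu0.
by have := cst_h _ Uu1; rewrite !flux_half// => ->; rewrite ltxx.
Qed.

(** * Necessary conditions on phi *)

Section Necessity.
Variable phi : R * R * R -> R.
Hypothesis sphi : smooth_on B phi.

Lemma has_Dx_lift (psi : R * R * R -> R) J : smooth_on B psi -> JB J ->
  has_Dx (lift_txu psi) J
    (lift_txu (part_x psi) J + ju J 0%N 1%N * lift_txu (part_u psi) J).
Proof.
move=> s JBJ; split; [exact: (Dx_regular_lift s JBJ)|exact: (Dx_lift s JBJ)].
Qed.

Let sx := smooth_part_x sphi.
Let su := smooth_part_u sphi.

(** With the order of differentiation kept, the coefficient of u_xx contains [part_u (part_x phi)]
    once and [part_x (part_u phi)] twice. *)
Lemma Dx3_lift J : JB J ->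
  let L := fun psi => lift_txu psi J in let u1 := ju J 0%N 1%N in
  Dx (Dx (Dx (lift_txu phi))) J =
    L (part_x (part_x (part_x phi))) + u1 * L (part_u (part_x (part_x phi)))
  + u1 * (L (part_x (part_u (part_x phi))) + u1 * L (part_u (part_u (part_x phi))))
  + u1 * (L (part_x (part_x (part_u phi))) + u1 * L (part_u (part_x (part_u phi))))
  + u1 * u1 * (L (part_x (part_u (part_u phi))) + u1 * L (part_u (part_u (part_u phi))))
  + 3 * u1 * ju J 0%N 2%N * L (part_u (part_u phi))
  + ju J 0%N 2%N * (L (part_u (part_x phi)) + 2 * L (part_x (part_u phi)))
  + ju J 0%N 3%N * L (part_u phi).
Proof.
move=> JBJ.
have D1 K : JB K -> Dx (lift_txu phi) K =
    lift_txu (part_x phi) K + ju K 0%N 1%N * lift_txu (part_u phi) K.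
  by move=> JBK; exact: (has_Dx_lift sphi JBK).2.
have D2 K : JB K -> Dx (Dx (lift_txu phi)) K =
    lift_txu (part_x (part_x phi)) K + ju K 0%N 1%N * lift_txu (part_u (part_x phi)) K
    + (ju K 0%N 1%N * (lift_txu (part_x (part_u phi)) K
                       + ju K 0%N 1%N * lift_txu (part_u (part_u phi)) K)
       + lift_txu (part_u phi) K * ju K 0%N 2%N).
  move=> JBK; rewrite (Dx_eq_on JBK D1).
  exact: (has_DxD (has_Dx_lift sx JBK)
    (has_DxM (has_Dx_ju K 0 1) (has_Dx_lift su JBK))).2.
rewrite (Dx_eq_on JBJ D2).
have [_ ->] := has_DxD
  (has_DxD (has_Dx_lift (smooth_part_x sx) JBJ)
    (has_DxM (has_Dx_ju J 0 1) (has_Dx_lift (smooth_part_u sx) JBJ)))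
  (has_DxD
    (has_DxM (has_Dx_ju J 0 1)
      (has_DxD (has_Dx_lift (smooth_part_x su) JBJ)
        (has_DxM (has_Dx_ju J 0 1) (has_Dx_lift (smooth_part_u su) JBJ))))
    (has_DxM (has_Dx_lift su JBJ) (has_Dx_ju J 0 2))).
by cbv beta zeta; abstract_partials; ring.
Qed.

Hypothesis nsa : realizes_nsa I X U (gkdv n A Q) phi.

(* Evaluating at the jets where F = 0, that is, eliminating u_t, makes the
   unknown factor lambda disappear. *)
Lemma nsa_identity t x u u1 u2 u3 : B (t, x, u) ->
  Q t * phi (t, x, u)
  - (part_t phi (t, x, u) - (h t u * u1 + u3 + Q t * u) * part_u phi (t, x, u))
  - h t u * (part_x phi (t, x, u) + u1 * part_u phi (t, x, u))
  - (part_x (part_x (part_x phi)) (t, x, u) + u1 * part_u (part_x (part_x phi)) (t, x, u)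
  + u1 * (part_x (part_u (part_x phi)) (t, x, u)
          + u1 * part_u (part_u (part_x phi)) (t, x, u))
  + u1 * (part_x (part_x (part_u phi)) (t, x, u)
          + u1 * part_u (part_x (part_u phi)) (t, x, u))
  + u1 * u1 * (part_x (part_u (part_u phi)) (t, x, u)
               + u1 * part_u (part_u (part_u phi)) (t, x, u))
  + 3 * u1 * u2 * part_u (part_u phi) (t, x, u)
  + u2 * (part_u (part_x phi) (t, x, u) + 2 * part_x (part_u phi) (t, x, u))
  + u3 * part_u phi (t, x, u)) = 0.
Proof.
move=> Btxu; have [_ _ [lambda _ lE]] := nsa.
(* Every coordinate with a t-derivative receives the value of u_t solved from F = 0; only u_t itself
   enters the formulas. *)
pose J := Jet t x (fun i j => if i is 0 then nth 0 [:: u; u1; u2; u3] j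
  else - (h t u * u1 + u3 + Q t * u)) (fun _ _ => 0).
have JBJ : JB J by [].
have := lE J JBJ.
rewrite (@subst_adjoint_gkdv _ n A Q I X U hpow phi J JBJ) (Dx3_lift JBJ).
rewrite (Dx_lift sphi JBJ) (Dt_lift sphi JBJ) /lift_txu /=.
have -> : gkdv n A Q J = 0 by rewrite /gkdv /J /= /flux; ring.
by rewrite mulr0 => <-; abstract_partials; ring.
Qed.

(** The mixed second difference in (u_x, u_xx) over the four corners 0 and 1 isolates the
    coefficient 3 phi_uu of u_x u_xx. *)
Lemma nsa_part_uu z : B z -> part_u (part_u phi) z = 0.
Proof.
case: z => [[t x] u] Bz.
have := nsa_identity 1 1 0 Bz; have := nsa_identity 1 0 0 Bz.
have := nsa_identity 0 1 0 Bz; have := nsa_identity 0 0 0 Bz.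
by abstract_partials; lra.
Qed.

Lemma nsa_part_xu z : B z -> part_u (part_x phi) z + 2 * part_x (part_u phi) z = 0.
Proof.
case: z => [[t x] u] Bz.
have := nsa_identity 0 1 0 Bz; have := nsa_identity 0 0 0 Bz.
by abstract_partials; lra.
Qed.

Lemma nsa_identity0 t x u : B (t, x, u) ->
  Q t * phi (t, x, u) - part_t phi (t, x, u) + Q t * u * part_u phi (t, x, u)
  - h t u * part_x phi (t, x, u) - part_x (part_x (part_x phi)) (t, x, u) = 0.
Proof. by move=> Bz; have := nsa_identity 0 0 0 Bz; abstract_partials; lra. Qed.

(** Once phi is affine in u for all x, differentiating that formula in x and then in u shows that
    both mixed partials equal [part_x (part_u phi)] at u0; [nsa_part_xu] then says that three times
    this value is 0. *)
Lemma nsa_affine_u t x u0 u : U u0 -> B (t, x, u) ->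
  [/\ part_u phi (t, x, u) = part_u phi (t, x, u0),
      phi (t, x, u) = part_u phi (t, x, u0) * (u - u0) + phi (t, x, u0) &
      part_x (part_u phi) (t, x, u) = 0].
Proof.
move=> Uu0; rewrite /box/= => -[It Xx Uu].
have Bu w : U w -> B (t, x, w) by [].
have Eu y w : X y -> U w -> part_u phi (t, y, w) = part_u phi (t, y, u0).
  move=> Xy Uw.
  have dg w' : U w' -> is_derive w' (1 : R) (fun s => part_u phi (t, y, s)) 0.
    move=> Uw'; have Bw' : B (t, y, w') by [].
    by have := is_derive_part_u su Bw'; rewrite nsa_part_uu.
  exact: (is_derive0_cst iU dg Uw Uu0).
have Ephi y w : X y -> U w ->
    phi (t, y, w) = part_u phi (t, y, u0) * (w - u0) + phi (t, y, u0).
  move=> Xy Uw.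
  have dg w' : U w' -> is_derive w' (1 : R)
      (fun s => phi (t, y, s) - part_u phi (t, y, u0) * s) 0.
    move=> Uw'; have Bw' : B (t, y, w') by [].
    apply: (is_derive_eq (is_deriveB (is_derive_part_u sphi Bw')
      (is_deriveZ (part_u phi (t, y, u0)) (is_derive_id w' 1)))).
    by rewrite Eu// -[X in _ - X]/(part_u phi (t, y, u0) * 1) mulr1 subrr.
  have := is_derive0_cst iU dg Uw Uu0; abstract_partials.
  by set a := phi _; set b := phi _; lra.
have Ex y w : X y -> U w ->
    part_x phi (t, y, w) =
      part_x (part_u phi) (t, y, u0) * (w - u0) + part_x phi (t, y, u0).
  move=> Xy Uw; have Bw : B (t, y, w) by [].
  have B0 : B (t, y, u0) by [].
  have dg := is_deriveD (is_deriveM (is_derive_part_x su B0)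
    (is_derive_cst (w - u0) y 1)) (is_derive_part_x sphi B0).
  rewrite (is_derive_eq_on oX Xy (fun z Xz => Ephi z w Xz Uw)
    (is_derive_part_x sphi Bw) dg).
  by rewrite scaler0 add0r -[X in X + _ = _]/(_ * _) mulrC.
have Exu : part_u (part_x phi) (t, x, u) = part_x (part_u phi) (t, x, u0).
  have dg := is_deriveD (is_deriveZ (part_x (part_u phi) (t, x, u0))
    (is_deriveB (is_derive_id u 1) (is_derive_cst u0 u 1)))
    (is_derive_cst (part_x phi (t, x, u0)) u 1).
  rewrite (is_derive_eq_on oU Uu (fun w Uw => Ex x w Xx Uw)
    (is_derive_part_u sx (Bu _ Uu)) dg).
  by rewrite subr0 addr0 -[LHS]/(_ * 1) mulr1.
have Eux : part_x (part_u phi) (t, x, u) = part_x (part_u phi) (t, x, u0).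
  exact: (is_derive_eq_on oX Xx (fun z Xz => Eu z u Xz Uu)
    (is_derive_part_x su (Bu _ Uu)) (is_derive_part_x su (Bu _ Uu0))).
split; [exact: Eu|exact: Ephi|].
by move: (nsa_part_xu (Bu _ Uu)) Exu Eux; abstract_partials; move=> *; lra.
Qed.

(** The coefficients are partial derivatives of phi at a base point (x0, u0), which makes them
    differentiable in t; taking differences of [nsa_identity0] between points of the box yields the
    equations they satisfy. *)
Lemma nsa_structure : exists p dp a c dc : R -> R,
  [/\ forall t, I t -> is_derive t (1 : R) p (dp t),
      forall t, I t -> is_derive t (1 : R) a (Q t * a t),
      forall t, I t -> is_derive t (1 : R) c (dc t),
      forall t x u, B (t, x, u) -> phi (t, x, u) = p t * u + a t * x + c t &
      forall t u, I t -> U u ->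
        h t u * a t = (2 * Q t * p t - dp t) * u + (Q t * c t - dc t)].
Proof.
have [_ _ [x0 Xx0]] := hX; have [_ _ [u0 Uu0]] := hU.
pose p t := part_u phi (t, x0, u0); pose dp t := part_t (part_u phi) (t, x0, u0).
pose a t := part_x phi (t, x0, u0).
pose b t := phi (t, x0, u0); pose db t := part_t phi (t, x0, u0).
have mkB t x u : I t -> X x -> U u -> B (t, x, u) by [].
have dpP t : I t -> is_derive t (1 : R) p (dp t).
  by move=> It; exact: (is_derive_part_t su (mkB _ _ _ It Xx0 Uu0)).
have daP t : I t -> is_derive t (1 : R) a (part_t (part_x phi) (t, x0, u0)).
  by move=> It; exact: (is_derive_part_t sx (mkB _ _ _ It Xx0 Uu0)).
have dbP t : I t -> is_derive t (1 : R) b (db t).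
  by move=> It; exact: (is_derive_part_t sphi (mkB _ _ _ It Xx0 Uu0)).
have pE0 t x : I t -> X x -> part_u phi (t, x, u0) = p t.
  move=> It Xx.
  have dg y : X y -> is_derive y (1 : R) (fun s => part_u phi (t, s, u0)) 0.
    move=> Xy; have By := mkB _ _ _ It Xy Uu0.
    by have := is_derive_part_x su By; have [_ _ ->] := nsa_affine_u Uu0 By.
  exact: (is_derive0_cst iX dg Xx Xx0).
have phiE t x u : I t -> X x -> U u ->
    phi (t, x, u) = p t * (u - u0) + phi (t, x, u0).
  move=> It Xx Uu; have [_ -> _] := nsa_affine_u Uu0 (mkB _ _ _ It Xx Uu).
  by rewrite pE0.
have pE t x u : I t -> X x -> U u -> part_u phi (t, x, u) = p t.
  move=> It Xx Uu; have [-> _ _] := nsa_affine_u Uu0 (mkB _ _ _ It Xx Uu).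
  exact: pE0.
have pxE t x u : I t -> X x -> U u -> part_x phi (t, x, u) = part_x phi (t, x, u0).
  move=> It Xx Uu.
  have dg := is_deriveD (is_derive_cst (p t * (u - u0)) x 1)
    (is_derive_part_x sphi (mkB _ _ _ It Xx Uu0)).
  rewrite (is_derive_eq_on oX Xx (fun z Xz => phiE t z u It Xz Uu)
    (is_derive_part_x sphi (mkB _ _ _ It Xx Uu)) dg).
  by rewrite add0r.
have ptE t x u : I t -> X x -> U u ->
    part_t phi (t, x, u) = dp t * (u - u0) + part_t phi (t, x, u0).
  move=> It Xx Uu.
  have dg := is_deriveD (is_deriveM (dpP t It) (is_derive_cst (u - u0) t 1))
    (is_derive_part_t sphi (mkB _ _ _ It Xx Uu0)).
  rewrite (is_derive_eq_on oI It (fun s Is => phiE s x u Is Xx Uu)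
    (is_derive_part_t sphi (mkB _ _ _ It Xx Uu)) dg).
  by rewrite scaler0 add0r -[X in X + _ = _]/(_ * _) mulrC.
have pxxE t x u : I t -> X x -> U u ->
    part_x (part_x phi) (t, x, u) = part_x (part_x phi) (t, x, u0).
  move=> It Xx Uu; exact: (is_derive_eq_on oX Xx (fun z Xz => pxE t z u It Xz Uu)
    (is_derive_part_x sx (mkB _ _ _ It Xx Uu))
    (is_derive_part_x sx (mkB _ _ _ It Xx Uu0))).
have pxxxE t x u : I t -> X x -> U u ->
    part_x (part_x (part_x phi)) (t, x, u) = part_x (part_x (part_x phi)) (t, x, u0).
  move=> It Xx Uu; exact: (is_derive_eq_on oX Xx (fun z Xz => pxxE t z u It Xz Uu)
    (is_derive_part_x (smooth_part_x sx) (mkB _ _ _ It Xx Uu))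
    (is_derive_part_x (smooth_part_x sx) (mkB _ _ _ It Xx Uu0))).
(* In the alternating sum of [nsa_identity0] over x, x0 and u1, u0, only the term h phi_x
   survives. *)
have aE t x : I t -> X x -> part_x phi (t, x, u0) = a t.
  move=> It Xx; have [u1 Uu1 hu1] := flux_neq It Uu0.
  suff : (h t u1 - h t u0) * (part_x phi (t, x, u0) - a t) = 0.
    by move/eqP; rewrite mulf_eq0 !subr_eq0 (negPf hu1)/= => /eqP.
  have := nsa_identity0 (mkB _ _ _ It Xx Uu1).
  have := nsa_identity0 (mkB _ _ _ It Xx Uu0).
  have := nsa_identity0 (mkB _ _ _ It Xx0 Uu1).
  have := nsa_identity0 (mkB _ _ _ It Xx0 Uu0).
  rewrite !(phiE _ _ u1)// !(ptE _ _ u1)// !(pxE _ _ u1)// !(pxxxE _ _ u1)// !pE//.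
  have -> : part_x phi (t, x0, u0) = a t by [].
  abstract_partials.
  move: (h t u1) (h t u0) (p t) (dp t) (a t) (phi (t, x, u0)) (phi (t, x0, u0)).
  by move=> *; lra.
have pxa t x u : I t -> X x -> U u -> part_x phi (t, x, u) = a t.
  by move=> It Xx Uu; rewrite pxE// aE.
have pxx0 t x u : I t -> X x -> U u -> part_x (part_x phi) (t, x, u) = 0.
  move=> It Xx Uu; exact: (is_derive_eq_on oX Xx (fun z Xz => pxa t z u It Xz Uu)
    (is_derive_part_x sx (mkB _ _ _ It Xx Uu)) (is_derive_cst (a t) x 1)).
have pxxx0 t x u : I t -> X x -> U u -> part_x (part_x (part_x phi)) (t, x, u) = 0.
  move=> It Xx Uu; exact: (is_derive_eq_on oX Xx (fun z Xz => pxx0 t z u It Xz Uu)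
    (is_derive_part_x (smooth_part_x sx) (mkB _ _ _ It Xx Uu))
    (is_derive_cst 0 x 1)).
have phi0E t x : I t -> X x -> phi (t, x, u0) = a t * (x - x0) + b t.
  move=> It Xx.
  have dg y : X y -> is_derive y (1 : R) (fun s => phi (t, s, u0) - a t * s) 0.
    move=> Xy; apply: (is_derive_eq (is_deriveB
      (is_derive_part_x sphi (mkB _ _ _ It Xy Uu0))
      (is_deriveZ (a t) (is_derive_id y 1)))).
    by rewrite pxa// -[X in _ - X]/(a t * 1) mulr1 subrr.
  have := is_derive0_cst iX dg Xx Xx0; rewrite /b.
  by move: (phi _) (phi _) (a t) => *; lra.
have pt0E t x : I t -> X x -> part_t phi (t, x, u0) =
    part_t (part_x phi) (t, x0, u0) * (x - x0) + db t.
  move=> It Xx.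
  have dg := is_deriveD (is_deriveM (daP t It) (is_derive_cst (x - x0) t 1)) (dbP t It).
  rewrite (is_derive_eq_on oI It (fun s Is => phi0E s x Is Xx)
    (is_derive_part_t sphi (mkB _ _ _ It Xx Uu0)) dg).
  by rewrite scaler0 add0r -[X in X + _ = _]/(_ * _) mulrC.
(* Subtracting [nsa_identity0] at x0 from that at x1, with u = u0, leaves (x1 - x0) times the
   equation for a. *)
have daE t : I t -> part_t (part_x phi) (t, x0, u0) = Q t * a t.
  move=> It; have [x1 Xx1 x01] := open_gt_ex oX Xx0.
  have x10 : x1 - x0 != 0 by rewrite subr_eq0 gt_eqF.
  apply: (mulIf x10).
  have := nsa_identity0 (mkB _ _ _ It Xx1 Uu0).
  have := nsa_identity0 (mkB _ _ _ It Xx0 Uu0).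
  rewrite !phi0E// !pt0E// !pxxx0// !pE// !pxa//.
  abstract_partials.
  move: (h t u0) (p t) (a t) (b t) (db t) => *; lra.
(* The third coefficient moves the expansion from the base point (x0, u0) to the origin. *)
exists p, dp, a, (fun t => b t - p t * u0 - a t * x0),
  (fun t => db t - dp t * u0 - Q t * a t * x0); split => //.
- by move=> t It; have := daP t It; rewrite daE.
- move=> t It; have := daP t It; rewrite daE// => da.
  have cstd (r : R) := is_derive_cst r t (1 : R).
  apply: (is_derive_eq (is_deriveB (is_deriveB (dbP t It)
    (is_deriveM (dpP t It) (cstd u0))) (is_deriveM da (cstd x0)))).
  rewrite !scaler0 !add0r.
  by rewrite -[LHS]/(db t - u0 * dp t - x0 * (Q t * a t)); ring.
- by move=> t x u [/= It Xx Uu]; rewrite phiE// phi0E//; ring.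
- move=> t u It Uu; have := nsa_identity0 (mkB _ _ _ It Xx0 Uu).
  rewrite phiE// ptE// phi0E// pt0E// daE// pxxx0// pE// pxa//.
  move: (h t u) (p t) (a t) (b t) (db t) (dp t) => *; lra.
Qed.

End Necessity.

End SelfAdjointness.

(** * Classification *)

Section Sufficiency.
Context {R : realType}.
Variables (n : R) (A Q : R -> R) (I X U : set R).
Hypotheses (hI : open_interval I) (hX : open_interval X)
  (hU : open_interval U) (hpow : powers_defined n A I U).

Let oI : open I. Proof. by case: hI. Qed.
Let oX : open X. Proof. by case: hX. Qed.
Let oU : open U. Proof. by case: hU. Qed.
Local Notation B := (box I X U).
Local Notation JB := (jet_box I X U).

Variables (phi : R * R * R -> R) (p dp a c : R -> R).
Hypotheses (sp : smooth_on I p) (sa : smooth_on I a) (sc : smooth_on I c).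
Hypothesis phiE : forall t x u, B (t, x, u) -> phi (t, x, u) = p t * u + a t * x + c t.

(** The projection to t, for the domain of phi and for that of lambda alike. *)
Let fst2 (V : normedModType R) : {linear (R * R * V)%type -> R} := fst \o fst.

Let continuous_fst2 (V : normedModType R) : continuous (@fst2 V).
Proof. by move=> z; apply: cvg_comp; exact: cvg_fst. Qed.

Lemma smooth_affine : smooth_on B phi.
Proof.
apply: smooth_gen_smooth; first exact: open_box.
pose lx : {linear (R * R * R)%type -> R} := snd \o fst.
have clx : continuous lx.
  by move=> z; apply: cvg_comp; [exact: cvg_fst|exact: cvg_snd].
pose lu : {linear (R * R * R)%type -> R} := snd.
have clu : continuous lu by move=> z; exact: cvg_snd.
have BI z : B z -> I (@fst2 R z) by case.
have G := sgen_add (sgen_add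
  (sgen_mul (sgen_comp (@continuous_fst2 R) BI sp) (sgen_lin B clu))
  (sgen_mul (sgen_comp (@continuous_fst2 R) BI sa) (sgen_lin B clx)))
  (sgen_comp (@continuous_fst2 R) BI sc).
apply: (sgen_eq _ G).
by move=> [[t x] u] Bz; rewrite phiE.
Qed.

Hypotheses (dpP : forall t, I t -> is_derive t (1 : R) p (dp t))
  (daP : forall t, I t -> is_derive t (1 : R) a (Q t * a t))
  (dcP : forall t, I t -> is_derive t (1 : R) c (Q t * c t)).
Hypothesis compat : forall t u, I t -> U u ->
  flux n A t u * a t = (2 * Q t * p t - dp t) * u.

Lemma realizes_affine : (exists2 z, B z & phi z != 0) ->
  realizes_nsa I X U (gkdv n A Q) phi.
Proof.
move=> phi0; split => //; first exact: smooth_affine.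
(* The coefficient of u_t is -phi_u = -p in the substituted adjoint and 1 in F. *)
exists (fun J => - p (jt J)).
  (* With N = 0 the matrix has u as its single entry; the factor -1 gives a product of
     generators. *)
  exists 0%N, (fun z : R * R * 'M[R]_1 => - 1 * p z.1.1); split; last first.
    by move=> J _; rewrite mulN1r.
  set D := [set _ | _]; have oD : open D.
    apply: (@open_comp _ _ (fun z : R * R * 'M[R]_1 => (z.1.1, z.1.2, z.2 ord0 ord0)) B);
      last exact: open_box.
    have cx : continuous (fun z : R * R * 'M[R]_1 => z.1.2).
      by move=> z; apply: cvg_comp; [exact: cvg_fst|exact: cvg_snd].
    have cu : continuous (fun z : R * R * 'M[R]_1 => z.2 ord0 ord0).
      move=> z; apply: (@continuous_comp _ _ _ snd (fun M : 'M[R]_1 => M ord0 ord0)).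
        exact: cvg_snd.
      exact: coord_continuous.
    move=> z _.
    exact (cvg_pair (cvg_pair (@continuous_fst2 _ z) (cx z)) (cu z)).
  apply: smooth_gen_smooth => //.
  have DI z : D z -> I (@fst2 _ z) by case.
  exact: (sgen_mul (sgen_cst D (- 1)) (sgen_comp (@continuous_fst2 _) DI sp)).
move=> J JBJ; have [/= It Xx Uu] := JBJ.
rewrite (@subst_adjoint_gkdv _ n A Q I X U hpow phi J JBJ).
have Bz : B (jt J, jx J, ju J 0%N 0%N) by [].
have cst1 (r s : R) := is_derive_cst r s (1 : R).
have DtE : Dt (lift_txu phi) J =
    dp (jt J) * ju J 0%N 0%N + Q (jt J) * a (jt J) * jx J + Q (jt J) * c (jt J)
    + ju J 1%N 0%N * p (jt J).
  rewrite (Dt_lift smooth_affine JBJ) /lift_txu; congr (_ + _ * _).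
    have dg := is_deriveD (is_deriveD
      (is_deriveM (dpP It) (cst1 (ju J 0%N 0%N) (jt J)))
      (is_deriveM (daP It) (cst1 (jx J) (jt J)))) (dcP It).
    rewrite (is_derive_eq_on oI It
      (fun s Is => @phiE s (jx J) (ju J 0%N 0%N) (And3 Is Xx Uu))
      (is_derive_part_t smooth_affine Bz) dg).
    rewrite !scaler0 !add0r.
    by rewrite -[LHS]/(ju J 0%N 0%N * dp (jt J) +
      jx J * (Q (jt J) * a (jt J)) + Q (jt J) * c (jt J)); ring.
  have dg := is_deriveD (is_deriveD
      (is_deriveZ (p (jt J)) (is_derive_id (ju J 0%N 0%N) 1))
      (cst1 (a (jt J) * jx J) (ju J 0%N 0%N))) (cst1 (c (jt J)) (ju J 0%N 0%N)).
  rewrite (is_derive_eq_on oU Uu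
      (fun s Us => @phiE (jt J) (jx J) s (And3 It Xx Us))
      (is_derive_part_u smooth_affine Bz) dg).
  by rewrite !addr0 -[LHS]/(p (jt J) * 1) mulr1.
have D1 K : JB K -> Dx (lift_txu phi) K = p (jt K) * ju K 0%N 1%N + a (jt K).
  move=> JBK; have [/= It' Xx' Uu'] := JBK.
  have Bz' : B (jt K, jx K, ju K 0%N 0%N) by [].
  have E J' : JB J' -> lift_txu phi J' =
      p (jt J') * ju J' 0%N 0%N + a (jt J') * jx J' + c (jt J').
    by move=> /phiE.
  rewrite (eq_on_jet_box_Dx oX oU E JBK).
  have [_ ->] := has_DxD (has_DxD (has_DxM (has_Dx_jt p K) (has_Dx_ju K 0 0))
    (has_DxM (has_Dx_jt a K) (has_Dx_jx K))) (has_Dx_jt c K).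
  by ring.
have D2 K : JB K -> Dx (Dx (lift_txu phi)) K = p (jt K) * ju K 0%N 2%N.
  move=> JBK; rewrite (eq_on_jet_box_Dx oX oU D1 JBK).
  have [_ ->] := has_DxD (has_DxM (has_Dx_jt p K) (has_Dx_ju K 0 1)) (has_Dx_jt a K).
  by ring.
have -> : Dx (Dx (Dx (lift_txu phi))) J = p (jt J) * ju J 0%N 3%N.
  rewrite (eq_on_jet_box_Dx oX oU D2 JBJ).
  have [_ ->] := has_DxM (has_Dx_jt p J) (has_Dx_ju J 0 2).
  by ring.
rewrite DtE (D1 J JBJ) /lift_txu phiE//.
have := compat It Uu; rewrite /gkdv /flux.
move: (rpow _ n) (rpow _ (2 * n)) (A _) (Q _) (p _) (a _) (c _) (dp _) => *; lra.
Qed.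

End Sufficiency.

(** * Integration of the equations for p, a and c *)

Section Classification.
Context {R : realType}.
Variables (n : R) (A Q : R -> R) (I X U : set R).
Hypotheses (n0 : 0 < n) (hI : open_interval I) (hX : open_interval X)
  (hU : open_interval U) (sQ : smooth_on I Q) (hpow : powers_defined n A I U).
Variables intQ intE : R -> R.
Hypotheses (intQP : antiderivative_on I Q intQ)
  (intEP : antiderivative_on I (fun t => expR (- intQ t)) intE).

Let oI : open I. Proof. by case: hI. Qed.

Lemma affine_eq0 (al be : R) : (forall u, U u -> al * u + be = 0) ->
  al = 0 /\ be = 0.
Proof.
move=> H; have [oU _ [u0 Uu0]] := hU.
have [u1 Uu1 u01] := open_gt_ex oU Uu0.
have al0 : al = 0.
  have u10 : u1 - u0 != 0 by rewrite subr_eq0 gt_eqF.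
  by apply: (mulIf u10); have := H _ Uu1; have := H _ Uu0; lra.
by split=> //; have := H _ Uu0; rewrite al0 mul0r add0r.
Qed.

Lemma is_derive_expR_scale k t : I t ->
  is_derive t (1 : R) (fun s => expR (k * intQ s)) (k * Q t * expR (k * intQ t)).
Proof. by move=> It; exact: (is_derive_expR_comp (is_deriveZ k (intQP It))). Qed.

(** The constant c2 is the one in a = c2 exp(int Q); the alternative on c2 lets one statement cover
    both cases. *)
Lemma realizes_nsaP phi : realizes_nsa I X U (gkdv n A Q) phi <->
  (exists2 z, box I X U z & phi z != 0) /\
  exists c1 c2 c3 : R, (c2 = 0 \/ n = 2^-1 /\ forall t, I t -> A t = 0) /\
    forall t x u, box I X U (t, x, u) ->
      phi (t, x, u) = (c1 * expR (2 * intQ t) - c2 * expR (2 * intQ t) * intE t) * u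
                      + (c2 * x + c3) * expR (intQ t).
Proof.
split=> [nsa|[phi0 [c1 [c2 [c3 [c20 phiE]]]]]].
  have [sphi phi0 _] := nsa; split=> //.
  have [p [dp [a [c [dc [dpP daP dcP phiE compat]]]]]] :=
    nsa_structure n0 hI hX hU hpow sphi nsa.
  have [a0 aE] := linear_ode_homo hI intQP daP.
  have a00 : a0 = 0 \/ n = 2^-1 /\ forall t, I t -> A t = 0.
    have [->|a00] := eqVneq a0 0; [by left|right].
    have at0 t : I t -> a t != 0 by move=> It; rewrite aE// mulf_neq0// gt_eqF// expR_gt0.
    have H t : I t -> n = 2^-1 /\ A t = 0.
      move=> It; apply: (flux_affine n0 hU hpow It
        (al := (2 * Q t * p t - dp t) / a t) (be := (Q t * c t - dc t) / a t)) => u Uu.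
      by apply: (mulIf (at0 t It)); rewrite compat//; field; exact: at0.
    by split=> [|t /H[]//]; have [_ _ [t0 /H[]]] := hI.
  (* In either alternative h a = a u: both sides vanish, or h = u. Hence [compat] is an affine
     identity in u and both coefficients vanish. *)
  have coef t : I t -> dp t = 2 * Q t * p t - a t /\ dc t = Q t * c t.
    move=> It.
    have [|al0 be0] := @affine_eq0 (2 * Q t * p t - dp t - a t) (Q t * c t - dc t).
      move=> u Uu; have := compat t u It Uu.
      have [a00'|[nE A0]] := a00; first by rewrite aE// a00' mul0r mulr0; lra.
      by rewrite flux_half// ?A0//; lra.
    by split; lra.
  have [c3 cE] : exists c3, forall t, I t -> c t = c3 * expR (intQ t).
    apply: linear_ode_homo hI intQP _ => t It.
    by have := dcP t It; have [_ ->] := coef t It.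
  (* The equation is p' = 2 Q p - a0 exp(int Q). The integrating factor exp(-2 int Q) turns the
     forcing term into -a0 exp(-int Q), which is where the antiderivative [intE] comes from. *)
  have [c1 pE] : exists c1, forall t, I t ->
      p t = (c1 + - a0 * intE t) * expR (2 * intQ t).
    apply: (@linear_ode _ I (fun t => 2 * Q t) (fun t => 2 * intQ t)
      (fun t => - a0 * expR (intQ t)) (fun t => - a0 * intE t) p hI).
    - by move=> t It; exact: (is_deriveZ 2 (intQP It)).
    - move=> t It; apply: (is_derive_eq (is_deriveZ (- a0) (intEP It))).
      rewrite -[LHS]/(- a0 * expR (- intQ t)) -mulrA -expRD; congr (_ * expR _).
      by ring.
    - move=> t It; have := dpP t It; have [-> _] := coef t It.
      by rewrite aE// mulNr.
  exists c1, a0, c3; split=> // t x u Btxu; have [/= It _ _] := Btxu.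
  by rewrite phiE// pE// aE// cE//; ring.
have sP : smooth_on I intQ := smooth_on_antiderivative oI sQ intQP.
have sP' : smooth_gen I intQ := sgen_smooth sP.
have sE : smooth_gen I intE.
  apply/sgen_smooth/(smooth_on_antiderivative oI _ intEP)/smooth_gen_smooth => //.
  apply/sgen_exp; apply: (sgen_eq _ (sgen_mul (sgen_cst I (- 1)) sP')).
  by move=> t _; rewrite mulN1r.
have sexp k : smooth_gen I (fun t => expR (k * intQ t)).
  by apply: sgen_exp; exact: sgen_mul (sgen_cst I k) sP'.
(* The factor 1 lets [sexp] and [is_derive_expR_scale] treat the exponents 1 and 2 alike. *)
pose a t := c2 * expR (1 * intQ t).
pose c t := c3 * expR (1 * intQ t).
pose p t := (c1 + - c2 * intE t) * expR (2 * intQ t).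
have dexp (r : R) t : I t -> is_derive t (1 : R) (fun s => r * expR (1 * intQ s))
    (Q t * (r * expR (1 * intQ t))).
  move=> It; apply: (is_derive_eq (is_deriveZ r (is_derive_expR_scale 1 It))).
  by rewrite -[LHS]/(r * _); ring.
apply: (@realizes_affine R n A Q I X U hI hX hU hpow phi p
  (fun t => 2 * Q t * p t - a t) a c _ _ _ _ _ (dexp c2) (dexp c3) _ phi0).
- apply: smooth_gen_smooth => //; apply: sgen_mul (sexp 2).
  exact: sgen_add (sgen_cst I c1) (sgen_mul (sgen_cst I (- c2)) sE).
- by apply: smooth_gen_smooth => //; exact: sgen_mul (sgen_cst I c2) (sexp 1).
- by apply: smooth_gen_smooth => //; exact: sgen_mul (sgen_cst I c3) (sexp 1).
- by move=> t x u Btxu; rewrite phiE// /p /a /c mul1r; ring.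
- move=> t It; apply: (is_derive_eq (is_deriveM
    (is_deriveD (is_derive_cst c1 t 1) (is_deriveZ (- c2) (intEP It)))
    (is_derive_expR_scale 2 It))).
  rewrite add0r -[LHS]/((c1 + - c2 * intE t) * (2 * Q t * expR (2 * intQ t)) +
    expR (2 * intQ t) * (- c2 * expR (- intQ t))) /p /a mul1r.
  have -> : expR (intQ t) = expR (2 * intQ t) * expR (- intQ t).
    by rewrite -expRD; congr expR; ring.
  by ring.
- move=> t u It Uu; case: c20 => [c20|[nE A0]].
    by rewrite /a c20 !mul0r mulr0; ring.
  by rewrite flux_half// ?A0//; ring.
Qed.

End Classification.

Theorem theorem3 (R : realType) (n : R) (I X U : set R) (A Q : R -> R)
    (hn : 0 < n)
    (hI : open_interval I) (hX : open_interval X) (hU : open_interval U)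
    (hA : smooth_on I A) (hQ : smooth_on I Q)
    (hpow : powers_defined n A I U) :
  nonlinearly_self_adjoint I X U (gkdv n A Q) /\
  forall (intQ intE : R -> R),
    antiderivative_on I Q intQ ->
    antiderivative_on I (fun t => expR (- intQ t)) intE ->
    (n = 2^-1 /\ (forall t, I t -> A t = 0) ->
     forall phi : R * R * R -> R,
       realizes_nsa I X U (gkdv n A Q) phi <->
       (exists2 z, box I X U z & phi z != 0) /\
       exists c1 c2 c3 : R,
         let p := fun t => c1 * expR (2 * intQ t)
                           - c2 * expR (2 * intQ t) * intE t in
         let q := fun t x => (c2 * x + c3) * expR (intQ t) in
         forall t x u, box I X U (t, x, u) -> phi (t, x, u) = p t * u + q t x) /\
    (~ (n = 2^-1 /\ (forall t, I t -> A t = 0)) ->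
     forall phi : R * R * R -> R,
       realizes_nsa I X U (gkdv n A Q) phi <->
       (exists2 z, box I X U z & phi z != 0) /\
       exists c1 c2 : R,
         let p := fun t => c1 * expR (2 * intQ t) in
         let q := fun t => c2 * expR (intQ t) in
         forall t x u, box I X U (t, x, u) -> phi (t, x, u) = p t * u + q t).
Proof.
have classif := realizes_nsaP hn hI hX hU hQ hpow.
split.
  have [oI _ [t0 It0]] := hI; have [_ _ [x0 Xx0]] := hX; have [_ _ [u0 Uu0]] := hU.
  have [intQ intQP] : exists P, antiderivative_on I Q P.
    apply: antiderivative_exists => // t It.
    exact/differentiable_continuous/(smooth_on_differentiable hQ It).
  have [intE intEP] : exists P, antiderivative_on I (fun t => expR (- intQ t)) P.
    apply: antiderivative_exists => // t It.
    apply/differentiable_continuous/derivable1_diffP.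
    by have [] := is_derive_expR_comp (is_deriveN (intQP _ It)).
  (* This is the choice c1 = c2 = 0 and c3 = 1: admissible in both cases and nowhere zero. *)
  exists (fun z => expR (intQ z.1.1)); apply/(classif _ _ intQP intEP); split.
    by exists (t0, x0, u0) => //=; rewrite gt_eqF// expR_gt0.
  by exists 0, 0, 1; split; [left|move=> t x u _ /=; ring].
move=> intQ intE intQP intEP; split=> [special|generic] phi.
  apply: (iff_trans (classif _ _ intQP intEP phi)).
  split=> -[phi0 [c1 [c2 [c3]]]].
    by move=> [_ phiE]; split=> //; exists c1, c2, c3.
  by move=> phiE; split=> //; exists c1, c2, c3; split=> //; right.
apply: (iff_trans (classif _ _ intQP intEP phi)).
(* Outside the exceptional case only c2 = 0 remains, and c3 takes over the name c2 of the
   statement. *)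
split=> [[phi0 [c1 [c2 [c3 [[c20|//] phiE]]]]]|[phi0 [c1 [c2 phiE]]]].
  split=> //; exists c1, c3 => p q t x u Btxu; rewrite phiE// c20 /p /q; ring.
split=> //; exists c1, 0, c2; split; [by left|move=> t x u Btxu].
by rewrite phiE//; ring.
Qed.
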